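(* Let $\alpha,\beta,\gamma\in\mathbb{R}$ with $\alpha,\gamma\neq 0$, and let $s<-3/2$. Consider the Cauchy problem $$\partial_t u+\alpha\,\partial_x^5u+\beta\,\partial_x^3u+\gamma\,\partial_x(u^2)=0,\quad (t,x)\in[0,T]\times\mathbb{T},\qquad u(0,x)=u_0(x),\quad x\in\mathbb{T}.$$ Then there is no $T>0$ such that the flow map $$\dot H^s(\mathbb{T})\ni u_0\mapsto u(t)\in\dot H^s(\mathbb{T})$$ is of class $C^3$ for every $t\in(0,T]$.
   Context: $\mathbb{T}=\mathbb{R}/2\pi\mathbb{Z}$ and $\dot{\mathbb{Z}}=\mathbb{Z}\setminus\{0\}$. $\dot H^s(\mathbb{T})$ is the space of mean-zero periodic distributions $\varphi$ (zero Fourier mode equal to $0$) with finite norm $\|\varphi\|_{\dot H^s(\mathbb{T})}=\|\langle k\rangle^s\widehat\varphi(k)\|_{\ell^2_k(\dot{\mathbb{Z}})}$, where $\langle k\rangle=(1+|k|^2)^{1/2}$. The flow map at time $t$ sends the initial datum $u_0$ to the value $u(t)$ at time $t$ of the solution of the Cauchy problem; for smooth mean-zero data the solution is the classical one, equivalently the solution of $u(t)=U(t)u_0-\gamma\int_0^tU(t-t')\partial_x(u(t')^2)\,dt'$ with $U(t)=\exp(-t(\alpha\partial_x^5+\beta\partial_x^3))$. $C^3$ means three times continuously Fréchet differentiable between the indicated spaces. *)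

(* Defs.v *)
From Stdlib Require Import Reals Lra Lia ZArith FunctionalExtensionality ProofIrrelevance.
From Coquelicot Require Import Coquelicot.

Open Scope R_scope.


Section BoundedOperators.

Variables E F : NormedModule R_AbsRing.

(* [is_linear] includes boundedness. *)
Record bounded_op : Type := Bounded_op {
  bop_fun :> E -> F;
  bop_linear : is_linear bop_fun }.

Lemma bop_ext (l m : bounded_op) : (forall x, l x = m x) -> l = m.
Proof.
  destruct l as [l Hl], m as [m Hm]; simpl; intros H.
  assert (Hlm : l = m) by (apply functional_extensionality; exact H).
  subst m; f_equal; apply proof_irrelevance.
Qed.

Lemma bop_plus_linear (l m : bounded_op) : is_linear (fun x => plus (l x) (m x)).
Proof.
  apply (is_linear_comp (fun x => (l x, m x)) (fun y => plus (fst y) (snd y))).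
  - apply is_linear_prod; apply bop_linear.
  - apply (@is_linear_plus R_AbsRing F).
Qed.

Lemma bop_opp_linear (l : bounded_op) : is_linear (fun x => opp (l x)).
Proof.
  apply (is_linear_comp l opp); [apply bop_linear | apply (@is_linear_opp R_AbsRing F)].
Qed.

Lemma bop_scal_linear (a : R) (l : bounded_op) : is_linear (fun x => scal a (l x)).
Proof.
  apply (is_linear_comp l (fun y => scal a y)); [apply bop_linear |].
  apply (@is_linear_scal_r R_AbsRing F). intros; apply Rmult_comm.
Qed.

Definition bop_plus (l m : bounded_op) := Bounded_op _ (bop_plus_linear l m).
Definition bop_opp (l : bounded_op) := Bounded_op _ (bop_opp_linear l).
Definition bop_scal (a : R) (l : bounded_op) := Bounded_op _ (bop_scal_linear a l).
Definition bop_zero := Bounded_op _ (@is_linear_zero R_AbsRing E F).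

Definition op_norm (l : bounded_op) : R :=
  real (Lub_Rbar (fun r => exists x : E, norm x <= 1 /\ r = norm (l x))).

Lemma norm_scal_R (V : NormedModule R_AbsRing) (a : R) (x : V) :
  norm (scal a x) = Rabs a * norm x.
Proof.
  apply Rle_antisym; [apply (norm_scal a x) |].
  destruct (Req_dec a 0) as [-> | Ha].
  - rewrite Rabs_R0, Rmult_0_l. apply norm_ge_0.
  - replace x with (scal (/ a) (scal a x)) at 1.
    + eapply Rle_trans.
      * apply Rmult_le_compat_l; [apply Rabs_pos |].
        apply (norm_scal (K := R_AbsRing) (/ a) (scal a x)).
      * change (abs (/ a)) with (Rabs (/ a)).
        rewrite <- Rmult_assoc, <- Rabs_mult, Rinv_r, Rabs_R1 by exact Ha. lra.
    + rewrite scal_assoc. change (mult (/ a) a) with (/ a * a).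
      rewrite Rinv_l by exact Ha. apply (@scal_one R_Ring V).
Qed.

Lemma op_norm_lub (l : bounded_op) :
  is_lub_Rbar (fun r => exists x : E, norm x <= 1 /\ r = norm (l x))
    (Finite (op_norm l)).
Proof.
  unfold op_norm.
  set (P := fun r => exists x : E, norm x <= 1 /\ r = norm (l x)).
  pose proof (Lub_Rbar_correct P) as [Hub Hleast].
  destruct (linear_norm _ (bop_linear l)) as [M [HM Hl]].
  assert (H0 : P 0).
  { exists zero. rewrite norm_zero, linear_zero by apply bop_linear.
    rewrite norm_zero. split; lra. }
  assert (H1 : Rbar_le (Lub_Rbar P) (Finite M)).
  { apply Hleast. intros r [x [Hx ->]]. simpl.
    eapply Rle_trans; [apply Hl |]. rewrite <- (Rmult_1_r M) at 2.
    apply Rmult_le_compat_l; lra. }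
  specialize (Hub 0 H0) as H2.
  destruct (Lub_Rbar P) as [r | |]; simpl in *; try contradiction.
  split; assumption.
Qed.

Lemma op_norm_ge_0 (l : bounded_op) : 0 <= op_norm l.
Proof.
  destruct (op_norm_lub l) as [Hub _]. apply (Hub 0).
  exists zero. rewrite norm_zero, linear_zero by apply bop_linear.
  rewrite norm_zero. split; lra.
Qed.

Lemma op_norm_bound (l : bounded_op) (x : E) : norm (l x) <= op_norm l * norm x.
Proof.
  destruct (Req_dec (norm x) 0) as [H0 | H0].
  - rewrite (norm_eq_zero x H0), linear_zero by apply bop_linear.
    rewrite !norm_zero. lra.
  - assert (Hx : 0 < norm x) by (pose proof (norm_ge_0 x); lra).
    destruct (op_norm_lub l) as [Hub _].
    assert (H : norm (l (scal (/ norm x) x)) <= op_norm l).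
    { apply (Hub (norm (l (scal (/ norm x) x)))). exists (scal (/ norm x) x).
      split; [| reflexivity]. rewrite norm_scal_R.
      rewrite Rabs_pos_eq by (left; apply Rinv_0_lt_compat; exact Hx).
      rewrite Rinv_l by exact H0. lra. }
    rewrite linear_scal in H by apply bop_linear.
    rewrite norm_scal_R in H.
    rewrite Rabs_pos_eq in H by (left; apply Rinv_0_lt_compat; exact Hx).
    apply Rmult_le_compat_r with (r := norm x) in H; [| lra].
    replace (norm (l x)) with (/ norm x * norm (l x) * norm x) by (field; exact H0).
    exact H.
Qed.

Lemma op_norm_le (l : bounded_op) (M : R) :
  0 <= M -> (forall x, norm (l x) <= M * norm x) -> op_norm l <= M.
Proof.
  intros HM H. destruct (op_norm_lub l) as [_ Hleast].
  apply (Hleast (Finite M)). intros r [x [Hx ->]]. simpl.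
  eapply Rle_trans; [apply H |]. rewrite <- (Rmult_1_r M) at 2.
  apply Rmult_le_compat_l; lra.
Qed.

Definition bop_AbelianMonoid_mixin : AbelianMonoid.mixin_of bounded_op.
Proof.
  apply (AbelianMonoid.Mixin bounded_op bop_plus bop_zero); intros; apply bop_ext;
    intros; simpl.
  - apply plus_comm.
  - apply plus_assoc.
  - apply plus_zero_r.
Defined.

Canonical bop_AbelianMonoid :=
  AbelianMonoid.Pack bounded_op bop_AbelianMonoid_mixin bounded_op.

Definition bop_AbelianGroup_mixin : AbelianGroup.mixin_of bop_AbelianMonoid.
Proof.
  apply (AbelianGroup.Mixin bop_AbelianMonoid bop_opp).
  intros; apply bop_ext; intros; simpl.
  exact (plus_opp_r (G := F) _).
Defined.

Canonical bop_AbelianGroup :=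
  AbelianGroup.Pack bounded_op
    (AbelianGroup.Class _ bop_AbelianMonoid_mixin bop_AbelianGroup_mixin) bounded_op.

Definition bop_ModuleSpace_mixin : ModuleSpace.mixin_of R_Ring bop_AbelianGroup.
Proof.
  apply (ModuleSpace.Mixin R_Ring bop_AbelianGroup bop_scal); intros; apply bop_ext;
    intros; simpl.
  - apply (@scal_assoc R_Ring F).
  - apply (@scal_one R_Ring F).
  - apply (@scal_distr_l R_Ring F).
  - apply (@scal_distr_r R_Ring F).
Defined.

Canonical bop_ModuleSpace :=
  ModuleSpace.Pack R_Ring bounded_op
    (ModuleSpace.Class R_Ring _ _ bop_ModuleSpace_mixin) bounded_op.

Lemma op_norm_triangle (l m : bounded_op) :
  op_norm (plus l m) <= op_norm l + op_norm m.
Proof.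
  apply op_norm_le.
  - pose proof (op_norm_ge_0 l); pose proof (op_norm_ge_0 m); lra.
  - intros x. eapply Rle_trans; [apply (norm_triangle (l x) (m x)) |].
    pose proof (op_norm_bound l x); pose proof (op_norm_bound m x). lra.
Qed.

Lemma op_norm_scal (a : R) (l : bounded_op) :
  op_norm (scal a l) <= Rabs a * op_norm l.
Proof.
  apply op_norm_le.
  - apply Rmult_le_pos; [apply Rabs_pos | apply op_norm_ge_0].
  - intros x. change (norm (scal a (l x)) <= Rabs a * op_norm l * norm x).
    rewrite norm_scal_R, Rmult_assoc.
    apply Rmult_le_compat_l; [apply Rabs_pos | apply op_norm_bound].
Qed.

Lemma op_norm_eq_zero (l : bounded_op) : op_norm l = 0 -> l = zero.
Proof.
  intros H. apply bop_ext. intros x.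
  change (l x = zero). apply norm_eq_zero.
  pose proof (op_norm_bound l x) as Hx. rewrite H, Rmult_0_l in Hx.
  apply Rle_antisym; [exact Hx | apply norm_ge_0].
Qed.

Definition bop_ball (l : bounded_op) (e : R) (m : bounded_op) : Prop :=
  op_norm (minus m l) < e.

Definition bop_UniformSpace_mixin : UniformSpace.mixin_of bounded_op.
Proof.
  apply (UniformSpace.Mixin bounded_op bop_zero bop_ball).
  - intros l e. unfold bop_ball. rewrite minus_eq_zero.
    apply Rle_lt_trans with 0; [| apply cond_pos].
    apply op_norm_le; [lra |]. intros x.
    change (norm (@zero F) <= 0 * norm x). rewrite norm_zero. lra.
  - intros l m e. unfold bop_ball. intros H.
    apply Rle_lt_trans with (2 := H).
    rewrite <- (opp_minus m l).
    rewrite <- (scal_opp_one (V := bop_ModuleSpace)).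
    eapply Rle_trans; [apply (op_norm_scal (@opp R_Ring one)) |].
    change (@opp R_Ring one) with (Ropp 1).
    rewrite Rabs_Ropp, Rabs_R1. lra.
  - intros l m n e1 e2. unfold bop_ball. intros H1 H2.
    rewrite (minus_trans m n l).
    eapply Rle_lt_trans; [apply op_norm_triangle |]. lra.
Defined.

Canonical bop_UniformSpace :=
  UniformSpace.Pack bounded_op bop_UniformSpace_mixin bounded_op.

Canonical bop_NormedModuleAux :=
  NormedModuleAux.Pack R_AbsRing bounded_op
    (NormedModuleAux.Class R_AbsRing _
       (ModuleSpace.class R_Ring bop_ModuleSpace) bop_UniformSpace_mixin) bounded_op.

Definition bop_NormedModule_mixin :
  NormedModule.mixin_of R_AbsRing bop_NormedModuleAux.
Proof.
  apply (NormedModule.Mixin R_AbsRing bop_NormedModuleAux op_norm 1).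
  - exact op_norm_triangle.
  - exact op_norm_scal.
  - intros l m e H; exact H.
  - intros l m e H; rewrite Rmult_1_l; exact H.
  - exact op_norm_eq_zero.
Defined.

Canonical bop_NormedModule : NormedModule R_AbsRing :=
  NormedModule.Pack R_AbsRing bounded_op
    (NormedModule.Class R_AbsRing _ _ bop_NormedModule_mixin) bounded_op.

End BoundedOperators.

Fixpoint class_C (n : nat) {E F : NormedModule R_AbsRing} (f : E -> F) : Prop :=
  match n with
  | O => forall x, continuous f x
  | S m => exists f' : E -> bop_NormedModule E F,
      (forall x, filterdiff f (locally x) (f' x)) /\ class_C m f'
  end.


Definition japanese (k : Z) : R := sqrt (1 + IZR k ^ 2).

Definition weighted_sq (s : R) (c : Z -> Complex.C) (k : Z) : R :=
  (Rpower (japanese k) s * Cmod (c k)) ^ 2.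

(* The contribution of the frequencies n+1 and -(n+1), so that the series of
   these terms is the sum over all nonzero integers. *)
Definition sobolev_term (s : R) (c : Z -> Complex.C) (n : nat) : R :=
  weighted_sq s c (Z.of_nat (S n)) + weighted_sq s c (- Z.of_nat (S n)).

(* A periodic distribution is given by its sequence of Fourier coefficients;
   it is real when that sequence is Hermitian. *)
Record Hdot (s : R) : Type := Build_Hdot {
  fcoef : Z -> Complex.C;
  fcoef_zero : fcoef 0%Z = RtoC 0;
  fcoef_real : forall k, fcoef (- k)%Z = Cconj (fcoef k);
  fcoef_summable : ex_series (sobolev_term s fcoef) }.

Arguments Build_Hdot {s} fcoef _ _ _.
Arguments fcoef {s} _ _.

Section SobolevSpace.

Variable s : R.

Lemma Hdot_ext (f g : Hdot s) : (forall k, fcoef f k = fcoef g k) -> f = g.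
Proof.
  destruct f as [f f1 f2 f3], g as [g g1 g2 g3]; simpl; intros H.
  assert (Hfg : f = g) by (apply functional_extensionality; exact H).
  subst g. rewrite (proof_irrelevance _ f1 g1), (proof_irrelevance _ f2 g2),
    (proof_irrelevance _ f3 g3). reflexivity.
Qed.

Lemma weighted_sq_ge_0 c k : 0 <= weighted_sq s c k.
Proof. apply pow2_ge_0. Qed.

Lemma sobolev_term_ge_0 c n : 0 <= sobolev_term s c n.
Proof. apply Rplus_le_le_0_compat; apply weighted_sq_ge_0. Qed.

Lemma weighted_sq_plus c d (p q : R) k : 0 < p -> 0 < q ->
  weighted_sq s (fun j => Cplus (c j) (d j)) k
  <= (1 + q / p) * weighted_sq s c k + (1 + p / q) * weighted_sq s d k.
Proof.
  intros Hp Hq. unfold weighted_sq.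
  set (w := Rpower (japanese k) s).
  assert (Hw : 0 < w) by apply exp_pos.
  set (a := w * Cmod (c k)). set (b := w * Cmod (d k)).
  assert (Ha : 0 <= a) by (apply Rmult_le_pos; [lra | apply Cmod_ge_0]).
  assert (Hb : 0 <= b) by (apply Rmult_le_pos; [lra | apply Cmod_ge_0]).
  apply Rle_trans with ((a + b) ^ 2).
  - apply pow_incr. split.
    + apply Rmult_le_pos; [lra | apply Cmod_ge_0].
    + unfold a, b. rewrite <- Rmult_plus_distr_l.
      apply Rmult_le_compat_l; [lra | apply Cmod_triangle].
  - assert (H : (1 + q / p) * a ^ 2 + (1 + p / q) * b ^ 2 - (a + b) ^ 2
                = (q * a - p * b) ^ 2 / (p * q)) by (field; lra).
    assert (0 <= (q * a - p * b) ^ 2 / (p * q)).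
    { apply Rmult_le_pos; [apply pow2_ge_0 |].
      left; apply Rinv_0_lt_compat, Rmult_lt_0_compat; assumption. }
    lra.
Qed.

Lemma sobolev_term_plus c d (p q : R) n : 0 < p -> 0 < q ->
  0 <= sobolev_term s (fun j => Cplus (c j) (d j)) n
  <= (1 + q / p) * sobolev_term s c n + (1 + p / q) * sobolev_term s d n.
Proof.
  intros Hp Hq. split; [apply sobolev_term_ge_0 |]. unfold sobolev_term.
  pose proof (weighted_sq_plus c d p q (Z.of_nat (S n)) Hp Hq).
  pose proof (weighted_sq_plus c d p q (- Z.of_nat (S n)) Hp Hq). lra.
Qed.

Lemma sobolev_term_scal c (a : R) n :
  sobolev_term s (fun j => Cmult (RtoC a) (c j)) n = a ^ 2 * sobolev_term s c n.
Proof.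
  unfold sobolev_term, weighted_sq. rewrite !Cmod_mult, !Cmod_R.
  rewrite !Rpow_mult_distr, <- (pow2_abs a). ring.
Qed.

Lemma ex_series_sobolev_bound c d (p q : R) :
  ex_series (sobolev_term s c) -> ex_series (sobolev_term s d) ->
  ex_series (fun n => (1 + q / p) * sobolev_term s c n
                      + (1 + p / q) * sobolev_term s d n).
Proof.
  intros Hc Hd.
  apply (ex_series_plus (fun n => (1 + q / p) * sobolev_term s c n)
           (fun n => (1 + p / q) * sobolev_term s d n)).
  - apply (ex_series_scal_l (1 + q / p) _ Hc).
  - apply (ex_series_scal_l (1 + p / q) _ Hd).
Qed.

Lemma ex_series_sobolev_plus c d :
  ex_series (sobolev_term s c) -> ex_series (sobolev_term s d) ->
  ex_series (sobolev_term s (fun j => Cplus (c j) (d j))).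
Proof.
  intros Hc Hd.
  apply (@ex_series_le R_AbsRing R_CompleteNormedModule) with
    (b := fun n => (1 + 1 / 1) * sobolev_term s c n
                   + (1 + 1 / 1) * sobolev_term s d n).
  - intros n. destruct (sobolev_term_plus c d 1 1 n Rlt_0_1 Rlt_0_1) as [H1 H2].
    change (norm (sobolev_term s (fun j => Cplus (c j) (d j)) n))
      with (Rabs (sobolev_term s (fun j => Cplus (c j) (d j)) n)).
    rewrite Rabs_pos_eq by exact H1. exact H2.
  - apply ex_series_sobolev_bound; assumption.
Qed.

Lemma ex_series_sobolev_scal c (a : R) :
  ex_series (sobolev_term s c) ->
  ex_series (sobolev_term s (fun j => Cmult (RtoC a) (c j))).
Proof.
  intros Hc. apply ex_series_ext with (fun n => a ^ 2 * sobolev_term s c n).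
  - intros n. symmetry. apply sobolev_term_scal.
  - apply (ex_series_scal_l (a ^ 2) _ Hc).
Qed.

Program Definition Hdot_zero : Hdot s := Build_Hdot (fun _ => RtoC 0) _ _ _.
Next Obligation. apply injective_projections; simpl; ring. Qed.
Next Obligation.
  apply ex_series_ext with (fun n => 0 * (/ 2) ^ n).
  - intros n. unfold sobolev_term, weighted_sq. rewrite Cmod_0.
    rewrite !Rmult_0_r, Rmult_0_l, pow_i by apply Nat.lt_0_2. symmetry. apply Rplus_0_r.
  - apply (ex_series_scal_l 0 (fun n => (/ 2) ^ n)), ex_series_geom. rewrite Rabs_pos_eq; lra.
Qed.

Program Definition Hdot_plus (f g : Hdot s) : Hdot s :=
  Build_Hdot (fun k => Cplus (fcoef f k) (fcoef g k)) _ _ _.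
Next Obligation. rewrite !fcoef_zero. apply Cplus_0_l. Qed.
Next Obligation. rewrite !fcoef_real, Cplus_conj. reflexivity. Qed.
Next Obligation. apply ex_series_sobolev_plus; apply fcoef_summable. Qed.

Program Definition Hdot_scal (a : R) (f : Hdot s) : Hdot s :=
  Build_Hdot (fun k => Cmult (RtoC a) (fcoef f k)) _ _ _.
Next Obligation. rewrite fcoef_zero. apply Cmult_0_r. Qed.
Next Obligation.
  rewrite fcoef_real, Cmult_conj. f_equal.
  apply injective_projections; simpl; ring.
Qed.
Next Obligation. apply ex_series_sobolev_scal; apply fcoef_summable. Qed.

Definition Hdot_opp (f : Hdot s) : Hdot s := Hdot_scal (- 1) f.

Definition Hdot_norm (f : Hdot s) : R := sqrt (Series (sobolev_term s (fcoef f))).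

Lemma Series_sobolev_ge_0 (f : Hdot s) : 0 <= Series (sobolev_term s (fcoef f)).
Proof.
  rewrite <- (Rmult_0_l (Series (sobolev_term s (fcoef f)))).
  rewrite <- Series_scal_l. apply Series_le; [| apply fcoef_summable].
  intros n. pose proof (sobolev_term_ge_0 (fcoef f) n). lra.
Qed.

Lemma weighted_le_Hdot_norm (f : Hdot s) (k : Z) :
  Rpower (japanese k) s * Cmod (fcoef f k) <= Hdot_norm f.
Proof.
  unfold Hdot_norm.
  assert (H0 : 0 <= Rpower (japanese k) s * Cmod (fcoef f k))
    by (apply Rmult_le_pos; [left; apply exp_pos | apply Cmod_ge_0]).
  destruct (Z.eq_dec k 0) as [-> | Hk].
  { rewrite fcoef_zero, Cmod_0, Rmult_0_r. apply sqrt_pos. }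
  rewrite <- (sqrt_pow2 _ H0). apply sqrt_le_1_alt.
  fold (weighted_sq s (fcoef f) k).
  set (n := Nat.pred (Z.abs_nat k)).
  apply Rle_trans with (sobolev_term s (fcoef f) n).
  - unfold sobolev_term.
    pose proof (weighted_sq_ge_0 (fcoef f) (Z.of_nat (S n))).
    pose proof (weighted_sq_ge_0 (fcoef f) (- Z.of_nat (S n))).
    assert (Hn : k = Z.of_nat (S n) \/ k = (- Z.of_nat (S n))%Z) by lia.
    destruct Hn as [Hn | Hn]; rewrite <- Hn in *; lra.
  - set (a := sobolev_term s (fcoef f)).
    rewrite <- (is_series_unique (fun j => if Nat.eq_dec j n then a n else 0) (a n)).
    + apply Series_le; [| apply fcoef_summable].
      intros j. pose proof (sobolev_term_ge_0 (fcoef f) j).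
      destruct (Nat.eq_dec j n) as [-> |]; unfold a; lra.
    + apply is_series_Reals. intros e He. exists n. intros m Hm.
      replace (sum_f_R0 (fun j => if Nat.eq_dec j n then a n else 0) m) with (a n).
      * unfold Rdist. rewrite Rminus_diag, Rabs_R0. exact He.
      * clearbody n a. induction m as [| m IH]; cbn [sum_f_R0].
        -- destruct (Nat.eq_dec 0 n); [reflexivity | lia].
        -- destruct (Nat.eq_dec (S m) n) as [Heq | Hneq].
           ++ rewrite sum_eq_R0; [symmetry; apply Rplus_0_l |].
              intros j Hj. destruct (Nat.eq_dec j n); [lia | reflexivity].
           ++ rewrite <- IH by lia. ring.
Qed.

Definition Hdot_AbelianMonoid_mixin : AbelianMonoid.mixin_of (Hdot s).
Proof.
  apply (AbelianMonoid.Mixin (Hdot s) Hdot_plus Hdot_zero); intros; apply Hdot_ext;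
    intros; simpl.
  - apply Cplus_comm.
  - apply Cplus_assoc.
  - apply Cplus_0_r.
Defined.

Canonical Hdot_AbelianMonoid :=
  AbelianMonoid.Pack (Hdot s) Hdot_AbelianMonoid_mixin (Hdot s).

Definition Hdot_AbelianGroup_mixin : AbelianGroup.mixin_of Hdot_AbelianMonoid.
Proof.
  apply (AbelianGroup.Mixin Hdot_AbelianMonoid Hdot_opp).
  intros f; apply Hdot_ext; intros k.
  change (Cplus (fcoef f k) (Cmult (RtoC (- 1)) (fcoef f k)) = RtoC 0).
  apply injective_projections; simpl; ring.
Defined.

Canonical Hdot_AbelianGroup :=
  AbelianGroup.Pack (Hdot s)
    (AbelianGroup.Class _ Hdot_AbelianMonoid_mixin Hdot_AbelianGroup_mixin) (Hdot s).

Definition Hdot_ModuleSpace_mixin : ModuleSpace.mixin_of R_Ring Hdot_AbelianGroup.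
Proof.
  apply (ModuleSpace.Mixin R_Ring Hdot_AbelianGroup Hdot_scal).
  - intros a b f; apply Hdot_ext; intros k; simpl.
    change (mult a b) with (a * b). rewrite RtoC_mult. ring.
  - intros f; apply Hdot_ext; intros k. apply Cmult_1_l.
  - intros a f g; apply Hdot_ext; intros k. apply Cmult_plus_distr_l.
  - intros a b f; apply Hdot_ext; intros k; simpl.
    change (plus a b) with (a + b). rewrite RtoC_plus. ring.
Defined.

Canonical Hdot_ModuleSpace :=
  ModuleSpace.Pack R_Ring (Hdot s)
    (ModuleSpace.Class R_Ring _ _ Hdot_ModuleSpace_mixin) (Hdot s).

Lemma Hdot_norm_triangle (f g : Hdot s) :
  Hdot_norm (plus f g) <= Hdot_norm f + Hdot_norm g.
Proof.
  assert (H : forall p q, Hdot_norm f < p -> Hdot_norm g < q ->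
            Hdot_norm (plus f g) <= p + q).
  { intros p q Hp Hq.
    assert (Hp0 : 0 < p) by (pose proof (sqrt_pos (Series (sobolev_term s (fcoef f)))); unfold Hdot_norm in *; lra).
    assert (Hq0 : 0 < q) by (pose proof (sqrt_pos (Series (sobolev_term s (fcoef g)))); unfold Hdot_norm in *; lra).
    assert (Hf : Series (sobolev_term s (fcoef f)) <= p ^ 2).
    { rewrite <- (pow2_sqrt _ (Series_sobolev_ge_0 f)). apply pow_incr.
      split; [apply sqrt_pos | left; exact Hp]. }
    assert (Hg : Series (sobolev_term s (fcoef g)) <= q ^ 2).
    { rewrite <- (pow2_sqrt _ (Series_sobolev_ge_0 g)). apply pow_incr.
      split; [apply sqrt_pos | left; exact Hq]. }
    rewrite <- (sqrt_pow2 (p + q)) by lra. apply sqrt_le_1_alt.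
    apply Rle_trans with
      ((1 + q / p) * Series (sobolev_term s (fcoef f))
       + (1 + p / q) * Series (sobolev_term s (fcoef g))).
    - rewrite <- !Series_scal_l, <- Series_plus.
      + apply Series_le.
        * intros n. apply sobolev_term_plus; assumption.
        * apply ex_series_sobolev_bound; apply fcoef_summable.
      + apply (ex_series_scal_l (1 + q / p) _ (fcoef_summable s f)).
      + apply (ex_series_scal_l (1 + p / q) _ (fcoef_summable s g)).
    - replace ((p + q) ^ 2) with ((1 + q / p) * p ^ 2 + (1 + p / q) * q ^ 2)
        by (field; lra).
      assert (0 < q / p) by (apply Rdiv_lt_0_compat; assumption).
      assert (0 < p / q) by (apply Rdiv_lt_0_compat; assumption).
      apply Rplus_le_compat; apply Rmult_le_compat_l; lra. }
  apply le_epsilon. intros e He.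
  specialize (H (Hdot_norm f + e / 2) (Hdot_norm g + e / 2)).
  lra.
Qed.

Lemma Hdot_norm_scal (a : R) (f : Hdot s) :
  Hdot_norm (scal a f) = Rabs a * Hdot_norm f.
Proof.
  unfold Hdot_norm.
  rewrite (Series_ext _ (fun n => a ^ 2 * sobolev_term s (fcoef f) n))
    by (intros n; apply sobolev_term_scal).
  rewrite Series_scal_l, sqrt_mult_alt by apply pow2_ge_0.
  rewrite <- pow2_abs, sqrt_pow2 by apply Rabs_pos. reflexivity.
Qed.

Lemma Hdot_norm_eq_zero (f : Hdot s) : Hdot_norm f = 0 -> f = zero.
Proof.
  intros H. apply Hdot_ext. intros k. change (fcoef f k = RtoC 0).
  apply Cmod_eq_0. pose proof (weighted_le_Hdot_norm f k) as Hk.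
  rewrite H in Hk.
  assert (Hw : 0 < Rpower (japanese k) s) by apply exp_pos.
  pose proof (Cmod_ge_0 (fcoef f k)). nra.
Qed.

Definition Hdot_ball (f : Hdot s) (e : R) (g : Hdot s) : Prop :=
  Hdot_norm (minus g f) < e.

Definition Hdot_UniformSpace_mixin : UniformSpace.mixin_of (Hdot s).
Proof.
  apply (UniformSpace.Mixin (Hdot s) Hdot_zero Hdot_ball).
  - intros f e. unfold Hdot_ball. rewrite minus_eq_zero.
    apply Rle_lt_trans with (Hdot_norm (scal 0 f)).
    + right. f_equal. apply Hdot_ext. intros k. symmetry. apply Cmult_0_l.
    + rewrite Hdot_norm_scal, Rabs_R0, Rmult_0_l. apply cond_pos.
  - intros f g e. unfold Hdot_ball. intros H.
    rewrite <- (opp_minus g f).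
    apply Rle_lt_trans with (Hdot_norm (scal (- 1) (minus g f))).
    + right. reflexivity.
    + rewrite Hdot_norm_scal, Rabs_m1, Rmult_1_l. exact H.
  - intros f g h e1 e2. unfold Hdot_ball. intros H1 H2.
    rewrite (minus_trans g h f).
    eapply Rle_lt_trans; [apply Hdot_norm_triangle |]. lra.
Defined.

Canonical Hdot_UniformSpace :=
  UniformSpace.Pack (Hdot s) Hdot_UniformSpace_mixin (Hdot s).

Canonical Hdot_NormedModuleAux :=
  NormedModuleAux.Pack R_AbsRing (Hdot s)
    (NormedModuleAux.Class R_AbsRing _
       (ModuleSpace.class R_Ring Hdot_ModuleSpace) Hdot_UniformSpace_mixin) (Hdot s).

Definition Hdot_NormedModule_mixin :
  NormedModule.mixin_of R_AbsRing Hdot_NormedModuleAux.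
Proof.
  apply (NormedModule.Mixin R_AbsRing Hdot_NormedModuleAux Hdot_norm 1).
  - exact Hdot_norm_triangle.
  - intros a f. right. apply Hdot_norm_scal.
  - intros f g e H; exact H.
  - intros f g e H; rewrite Rmult_1_l; exact H.
  - exact Hdot_norm_eq_zero.
Defined.

Canonical Hdot_NormedModule : NormedModule R_AbsRing :=
  NormedModule.Pack R_AbsRing (Hdot s)
    (NormedModule.Class R_AbsRing _ _ Hdot_NormedModule_mixin) (Hdot s).

End SobolevSpace.


(* Functions on the torus are 2*PI-periodic functions on the line. *)
Definition periodic (f : R -> R) : Prop := forall x, f (x + 2 * PI) = f x.

Definition smooth (f : R -> R) : Prop := forall n x, ex_derive_n f n x.

Definition mean_zero (f : R -> R) : Prop := RInt f 0 (2 * PI) = 0.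

(* (1 / 2 pi) * the integral of f(x) exp(-ikx) over a period. *)
Definition fourier (f : R -> R) (k : Z) : Complex.C :=
  (/ (2 * PI) * RInt (fun x => f x * cos (IZR k * x)) 0 (2 * PI),
   - (/ (2 * PI) * RInt (fun x => f x * sin (IZR k * x)) 0 (2 * PI))).

Definition represents {s : R} (phi : Hdot s) (f : R -> R) : Prop :=
  forall k, fcoef phi k = fourier f k.

(* The values of [u] at times outside [0, T] are irrelevant: a solution on
   [0, T] with one-sided time derivatives at the end points extends to a function
   on the line that is differentiable in time at 0 and T. *)
Record classical_solution (alpha beta gamma T : R) (u0 : R -> R) (u : R -> R -> R)
  : Prop := {
  sol_periodic : forall t, 0 <= t <= T -> periodic (u t);
  sol_initial : forall x, u 0 x = u0 x;
  sol_dt : forall t x, 0 <= t <= T -> ex_derive (fun tau => u tau x) t;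
  sol_dx : forall j t x, (j <= 5)%nat -> 0 <= t <= T -> ex_derive_n (u t) j x;
  sol_dx_continuous : forall j, (j <= 5)%nat ->
    continuous_on (fun p : R * R => 0 <= fst p <= T)
      (fun p => Derive_n (u (fst p)) j (snd p));
  sol_equation : forall t x, 0 <= t <= T ->
    Derive (fun tau => u tau x) t
    + alpha * Derive_n (u t) 5 x + beta * Derive_n (u t) 3 x
    + gamma * Derive (fun y => u t y ^ 2) x = 0 }.

(* This prescribes [S] on smooth data only; these are dense, so a continuous [S]
   is the unique continuous extension of the classical flow to the whole space. *)
Definition is_flow_map (alpha beta gamma t : R) {s : R} (S : Hdot s -> Hdot s) : Prop :=
  forall (u0 : R -> R) (phi : Hdot s),
    periodic u0 -> smooth u0 -> mean_zero u0 -> represents phi u0 ->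
    exists u, classical_solution alpha beta gamma t u0 u /\ represents (S phi) (u t).

(* Main.v *)
(** Take the data 2 h cos(N x) and let u be the solution. Its energy <u^2> = 2 h^2 is
    conserved, so each Fourier coefficient of u, once the free evolution is removed, moves
    by O(h^2); conservation of energy also shows that v = u - 2 h cos(N x - omega t) has
    <v^2> = 4 h (h - Re a_N) = O(h^3), where a_N is the normalised coefficient of the mode N.
    Hence the interactions can be computed mode by mode without any smooth dependence of u
    on h, and bootstrapping twice gives Im a_N(T) = c_N h^3 + O(h^4), where c_N comes from
    N + N -> 2N followed by 2N - N -> N and |c_N| >= const * T * N^-3, since the resonance
    function is of size N^5. If the flow were C^3, the third difference in h of Im a_N would
    be at most const * ||cos(N x)||^3 * N^-s * h^3, that is const * N^(2s) * h^3, which is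
    impossible for large N when s < -3/2. *)

Require Import Defs.
From Stdlib Require Import Reals Lra Lia ZArith.
From Coquelicot Require Import Coquelicot.
Open Scope R_scope.

(** * Averages over the torus *)


Definition mean (f : R -> R) : R := / (2 * PI) * RInt f 0 (2 * PI).

Lemma ex_RInt_cont (f : R -> R) (a b : R) :
  (forall x, continuous f x) -> ex_RInt f a b.
Proof. intros Hf. apply @ex_RInt_continuous. intros z _. apply Hf. Qed.

Lemma inv_2PI_gt_0 : 0 < / (2 * PI).
Proof. apply Rinv_0_lt_compat. pose proof PI_RGT_0. lra. Qed.

Lemma mean_ext (f g : R -> R) : (forall x, f x = g x) -> mean f = mean g.
Proof.
  intros H. unfold mean. f_equal. apply RInt_ext. intros x _. apply H.
Qed.

Lemma mean_plus (f g : R -> R) :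
  (forall x, continuous f x) -> (forall x, continuous g x) ->
  mean (fun x => f x + g x) = mean f + mean g.
Proof.
  intros Hf Hg. unfold mean.
  rewrite (RInt_plus f g) by (apply ex_RInt_cont; assumption).
  change plus with Rplus. ring.
Qed.

Lemma mean_scal (c : R) (f : R -> R) :
  (forall x, continuous f x) -> mean (fun x => c * f x) = c * mean f.
Proof.
  intros Hf. unfold mean.
  rewrite (RInt_scal f) by (apply ex_RInt_cont; assumption).
  change scal with Rmult. ring.
Qed.

Lemma Rabs_mean_le (f g : R -> R) :
  (forall x, continuous f x) -> (forall x, continuous g x) ->
  (forall x, Rabs (f x) <= g x) -> Rabs (mean f) <= mean g.
Proof.
  intros Hf Hg H. unfold mean. pose proof PI_RGT_0 as Hpi.
  pose proof inv_2PI_gt_0 as Hi.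
  rewrite Rabs_mult, (Rabs_pos_eq (/ (2 * PI))) by lra.
  apply Rmult_le_compat_l; [lra |].
  eapply Rle_trans.
  - apply abs_RInt_le; [lra | apply ex_RInt_cont, Hf].
  - apply RInt_le; [lra | | apply ex_RInt_cont, Hg | intros; apply H].
    apply ex_RInt_cont. intros x. apply continuous_comp; [apply Hf |].
    apply (continuous_abs (K := R_AbsRing)).
Qed.

Lemma mean_derive_periodic (F f : R -> R) :
  (forall x, is_derive F x (f x)) -> (forall x, continuous f x) ->
  periodic F -> mean f = 0.
Proof.
  intros HF Hf Hp. unfold mean.
  rewrite (is_RInt_unique f 0 (2 * PI) (minus (F (2 * PI)) (F 0))).
  - rewrite <- (Rplus_0_l (2 * PI)) at 2. rewrite (Hp 0), minus_eq_zero.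
    apply Rmult_0_r.
  - apply @is_RInt_derive; intros; [apply HF | apply Hf].
Qed.

Lemma periodic_cos_IZR (m : Z) (c : R) : periodic (fun x => cos (IZR m * x + c)).
Proof.
  intros x. destruct (Z.le_ge_cases 0 m) as [Hm | Hm].
  - rewrite <- (Z2Nat.id m Hm), <- INR_IZR_INZ.
    replace (INR (Z.to_nat m) * (x + 2 * PI) + c)
      with (INR (Z.to_nat m) * x + c + 2 * INR (Z.to_nat m) * PI) by ring.
    apply cos_period.
  - rewrite <- (Z.opp_involutive m), <- (Z2Nat.id (- m)), opp_IZR, <- INR_IZR_INZ by lia.
    set (n := Z.to_nat (- m)).
    rewrite <- (cos_period (- INR n * (x + 2 * PI) + c) n). f_equal. ring.
Qed.

(** Orthogonality of the trigonometric system. The free phase [c] covers sines and cosines at once,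
    and every explicit average below reduces to this case. *)
Lemma mean_cos (m : Z) (c : R) :
  mean (fun x => cos (IZR m * x + c)) = if Z.eq_dec m 0 then cos c else 0.
Proof.
  destruct (Z.eq_dec m 0) as [-> | Hm].
  - unfold mean. rewrite (RInt_ext _ (fun _ => cos c)).
    + rewrite RInt_const. change scal with Rmult. simpl. pose proof PI_RGT_0. field. lra.
    + intros x _. f_equal. ring.
  - assert (Hm' : IZR m <> 0) by (apply not_0_IZR, Hm).
    apply (mean_derive_periodic (fun x => / IZR m * sin (IZR m * x + c))).
    + intros x. auto_derive; [easy |]. field. exact Hm'.
    + intros x. apply (ex_derive_continuous (fun y => cos (IZR m * y + c))).
      auto_derive. easy.
    (* The sine is a cosine of frequency [- m] with a shifted phase, so the cosine lemma gives its
       periodicity. *)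
    + intros x. f_equal.
      rewrite <- !(cos_shift (_ + c)).
      replace (PI / 2 - (IZR m * (x + 2 * PI) + c))
        with (IZR (- m) * (x + 2 * PI) + (PI / 2 - c)) by (rewrite opp_IZR; ring).
      rewrite (periodic_cos_IZR (- m) (PI / 2 - c) x). f_equal. rewrite opp_IZR. ring.
Qed.

(** * Averages depending on time *)

Definition jointly_continuous (f : R -> R -> R) : Prop :=
  forall p : R * R, continuous (fun q : R * R => f (fst q) (snd q)) p.

Lemma jointly_continuous_2d (f : R -> R -> R) (t x : R) :
  jointly_continuous f -> continuity_2d_pt f t x.
Proof. intros Hf. apply continuity_2d_pt_filterlim. apply (Hf (t, x)). Qed.

Lemma jointly_continuous_snd (f : R -> R -> R) (t x : R) :
  jointly_continuous f -> continuous (f t) x.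
Proof.
  intros Hf.
  apply (continuous_comp_2 (fun _ => t) (fun y => y) f).
  - apply continuous_const.
  - apply continuous_id.
  - apply Hf.
Qed.

Lemma mean_param_continuous (f : R -> R -> R) (t : R) :
  jointly_continuous f -> continuity_pt (fun tau => mean (f tau)) t.
Proof.
  intros Hf. apply continuity_pt_filterlim. apply filterlim_locally. intros eps.
  pose proof PI_RGT_0 as Hpi. pose proof inv_2PI_gt_0 as Hi.
  destruct (uniform_continuity_2d_1d' f 0 (2 * PI) t
              (fun x _ => jointly_continuous_2d f t x Hf) (pos_div_2 eps)) as [d Hd].
  exists d. intros y Hy. change (Rabs (y - t) < d) in Hy.
  change (Rabs (mean (f y) - mean (f t)) < eps).
  assert (Hc : forall tau x, continuous (f tau) x)
    by (intros; apply jointly_continuous_snd, Hf).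
  apply Rle_lt_trans with (eps / 2); [| pose proof (cond_pos eps); lra].
  unfold mean. rewrite <- Rmult_minus_distr_l.
  change Rminus with (@minus R_AbelianGroup).
  rewrite <- (RInt_minus (f y) (f t)) by (apply ex_RInt_cont, Hc).
  rewrite Rabs_mult, (Rabs_pos_eq (/ (2 * PI))) by lra.
  apply Rle_trans with (/ (2 * PI) * ((2 * PI - 0) * (eps / 2))).
  - apply Rmult_le_compat_l; [lra |].
    apply abs_RInt_le_const; [lra | |].
    + apply ex_RInt_cont. intros x.
      apply (continuous_minus (V := R_NormedModule)); apply Hc.
    + intros x Hx. left. apply Rabs_def2 in Hy.
      apply (Hd x t x y); try lra; try (pose proof (cond_pos d); lra).
      rewrite Rminus_diag, Rabs_R0. apply cond_pos.
  - right. field. lra.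
Qed.

Lemma mean_param_derive (f g : R -> R -> R) (a b t : R) :
  jointly_continuous f -> jointly_continuous g -> a < t < b ->
  (forall tau x, a < tau < b -> is_derive (fun z => f z x) tau (g tau x)) ->
  is_derive (fun tau => mean (f tau)) t (mean (g t)).
Proof.
  intros Hf Hg Ht Hd.
  assert (Hloc : locally t (fun tau => a < tau < b)).
  { apply (open_and (fun tau => a < tau) (fun tau => tau < b));
      [apply open_gt | apply open_lt | exact Ht]. }
  unfold mean.
  apply (is_derive_scal (fun tau => RInt (f tau) 0 (2 * PI))).
  rewrite (RInt_ext (g t) (fun x => Derive (fun z => f z x) t)).
  - apply is_derive_RInt_param.
    + apply filter_imp with (2 := Hloc). intros tau Htau x _.
      exists (g tau x). apply Hd, Htau.
    + intros x _. apply continuity_2d_pt_ext_loc with g.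
      * destruct Hloc as [d Hloc]. exists d. intros u v Hu _.
        symmetry. apply is_derive_unique, Hd, Hloc. exact Hu.
      * apply jointly_continuous_2d, Hg.
    + apply filter_forall. intros tau. apply ex_RInt_cont. intros x.
      apply jointly_continuous_snd, Hf.
  - intros x _. symmetry. apply is_derive_unique, Hd, Ht.
Qed.

(** A density obeying [rho_t = sigma + flux_x] keeps only its source after averaging, since a
    periodic flux contributes nothing. Conservation of energy and the evolution of single modes are
    both instances. *)
Lemma mean_balance (rho sigma flux dflux : R -> R -> R) (T t : R) :
  jointly_continuous rho -> jointly_continuous sigma -> jointly_continuous dflux ->
  (forall tau x, 0 < tau < T ->
     is_derive (fun z => rho z x) tau (sigma tau x + dflux tau x)) ->
  (forall tau x, is_derive (flux tau) x (dflux tau x)) ->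
  (forall tau, periodic (flux tau)) ->
  0 < t < T -> is_derive (fun tau => mean (rho tau)) t (mean (sigma t)).
Proof.
  intros Hrho Hsigma Hdflux Hd Hflux Hper Ht.
  replace (mean (sigma t)) with (mean (fun x => sigma t x + dflux t x)).
  - apply (mean_param_derive rho (fun tau x => sigma tau x + dflux tau x) 0 T);
      try assumption.
    intros p. apply (continuous_plus (V := R_NormedModule)); [apply Hsigma | apply Hdflux].
  - rewrite mean_plus by (intros x; apply jointly_continuous_snd; assumption).
    rewrite (mean_derive_periodic (flux t) (dflux t)); [ring | apply Hflux | | apply Hper].
    intros x. apply jointly_continuous_snd, Hdflux.
Qed.

(** The mean value theorem for [f - e]. With [e] an explicit approximate primitive, it replaces
    integration in time in Duhamel's formula. *)
Lemma increment_bound (f df e de : R -> R) (T K t : R) :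
  (forall x, continuity_pt f x) ->
  (forall x, 0 < x < T -> is_derive f x (df x)) ->
  (forall x, is_derive e x (de x)) ->
  (forall x, 0 < x < T -> Rabs (df x - de x) <= K) ->
  0 <= t <= T -> Rabs (f t - f 0 - (e t - e 0)) <= K * t.
Proof.
  intros Hf Hdf He HK Ht.
  destruct (Req_dec t 0) as [-> | Ht0].
  { replace (f 0 - f 0 - (e 0 - e 0)) with 0 by ring. rewrite Rabs_R0. lra. }
  destruct (MVT_gen (fun x => f x - e x) 0 t
              (* The intermediate point may be an endpoint, where [df] is not known to be the
                 derivative. The default value 0 still obeys the bound because [K] is
                 nonnegative. *)
              (fun x => if Rlt_dec 0 x then if Rlt_dec x T then df x - de x else 0 else 0))
    as [c [_ Hc]].
  - intros x. rewrite Rmin_left, Rmax_right by lra. intros Hx.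
    destruct (Rlt_dec 0 x); [| lra]. destruct (Rlt_dec x T); [| lra].
    apply (is_derive_minus f e); [apply Hdf; lra | apply He].
  - intros x _. apply continuity_pt_minus; [apply Hf |].
    apply continuity_pt_filterlim, (ex_derive_continuous e). exists (de x). apply He.
  - replace (f t - f 0 - (e t - e 0)) with (f t - e t - (f 0 - e 0)) by ring.
    rewrite Hc, Rminus_0_r, Rabs_mult, (Rabs_pos_eq t) by lra.
    apply Rmult_le_compat_r; [lra |].
    assert (HK0 : 0 <= K).
    { eapply Rle_trans; [apply Rabs_pos | apply (HK (t / 2)); lra]. }
    destruct (Rlt_dec 0 c); [destruct (Rlt_dec c T) |].
    + apply HK; lra.
    + rewrite Rabs_R0. exact HK0.
    + rewrite Rabs_R0. exact HK0.
Qed.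

(** * Balance laws for classical solutions *)


Lemma jointly_continuous_const (c : R) : jointly_continuous (fun _ _ => c).
Proof. intros p. apply continuous_const. Qed.

Lemma jointly_continuous_time : jointly_continuous (fun t _ => t).
Proof. intros p. apply (continuous_fst (fst p) (snd p)). Qed.

Lemma jointly_continuous_space : jointly_continuous (fun _ x => x).
Proof. intros p. apply (continuous_snd (fst p) (snd p)). Qed.

Lemma jointly_continuous_plus (f g : R -> R -> R) :
  jointly_continuous f -> jointly_continuous g ->
  jointly_continuous (fun t x => f t x + g t x).
Proof.
  intros Hf Hg p. apply (continuous_plus (V := R_NormedModule)); [apply Hf | apply Hg].
Qed.

Lemma jointly_continuous_mult (f g : R -> R -> R) :
  jointly_continuous f -> jointly_continuous g ->
  jointly_continuous (fun t x => f t x * g t x).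
Proof.
  intros Hf Hg p. apply (continuous_mult (K := R_AbsRing)); [apply Hf | apply Hg].
Qed.

Lemma jointly_continuous_opp (f : R -> R -> R) :
  jointly_continuous f -> jointly_continuous (fun t x => - f t x).
Proof. intros Hf p. apply (continuous_opp (V := R_NormedModule)), Hf. Qed.

Lemma jointly_continuous_minus (f g : R -> R -> R) :
  jointly_continuous f -> jointly_continuous g ->
  jointly_continuous (fun t x => f t x - g t x).
Proof.
  intros Hf Hg. apply jointly_continuous_plus; [exact Hf |].
  apply jointly_continuous_opp, Hg.
Qed.

Lemma jointly_continuous_pow (f : R -> R -> R) (n : nat) :
  jointly_continuous f -> jointly_continuous (fun t x => f t x ^ n).
Proof.
  intros Hf. induction n as [| n IH].
  - exact (jointly_continuous_const 1).
  - apply jointly_continuous_mult; [exact Hf | exact IH].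
Qed.

Lemma jointly_continuous_cos (f : R -> R -> R) :
  jointly_continuous f -> jointly_continuous (fun t x => cos (f t x)).
Proof.
  intros Hf p. apply (continuous_comp (fun q : R * R => f (fst q) (snd q)) cos).
  - apply Hf.
  - apply continuous_cos.
Qed.

Lemma jointly_continuous_sin (f : R -> R -> R) :
  jointly_continuous f -> jointly_continuous (fun t x => sin (f t x)).
Proof.
  intros Hf p. apply (continuous_comp (fun q : R * R => f (fst q) (snd q)) sin).
  - apply Hf.
  - apply continuous_sin.
Qed.

(* Syntactic matching, since plain [apply] would try to unfold [cos] and [Rminus]. *)
Ltac jointly_continuous_tac :=
  repeat match goal with
    | H : jointly_continuous ?f |- jointly_continuous ?f => exact H
    | |- jointly_continuous (fun _ _ => ?c) => apply (jointly_continuous_const c)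
    | |- jointly_continuous (fun t _ => t) => apply jointly_continuous_time
    | |- jointly_continuous (fun _ x => x) => apply jointly_continuous_space
    | |- jointly_continuous (fun t x => @?f t x - @?g t x) =>
        apply (jointly_continuous_minus f g)
    | |- jointly_continuous (fun t x => @?f t x + @?g t x) =>
        apply (jointly_continuous_plus f g)
    | |- jointly_continuous (fun t x => @?f t x * @?g t x) =>
        apply (jointly_continuous_mult f g)
    | |- jointly_continuous (fun t x => - @?f t x) =>
        apply (jointly_continuous_opp f)
    | |- jointly_continuous (fun t x => @?f t x ^ ?n) =>
        apply (jointly_continuous_pow f n)
    | |- jointly_continuous (fun t x => cos (@?f t x)) =>
        apply (jointly_continuous_cos f)
    | |- jointly_continuous (fun t x => sin (@?f t x)) =>
        apply (jointly_continuous_sin f)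
    end.

(* [w j] stands for the j-th space derivative of a solution, frozen in time outside
   [0, T] so that it is continuous on the whole plane. *)
Record solution_jet (alpha beta gamma T : R) (u0 : R -> R) (w : nat -> R -> R -> R)
  : Prop := {
  jet_continuous : forall j, (j <= 5)%nat -> jointly_continuous (w j);
  jet_periodic : forall j t, periodic (w j t);
  jet_dx : forall j t x, (j < 5)%nat -> is_derive (w j t) x (w (S j) t x);
  jet_dt : forall t x, 0 < t < T ->
    is_derive (fun z => w 0%nat z x) t
      (- (alpha * w 5%nat t x + beta * w 3%nat t x
          + 2 * gamma * (w 0%nat t x * w 1%nat t x)));
  jet_initial : forall x, w 0%nat 0 x = u0 x }.

(** For nonnegative [T], the nearest-point projection of the line onto the interval from 0 to
    [T]. *)
Definition clamp (T t : R) : R := Rmax 0 (Rmin t T).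

Lemma clamp_id (T t : R) : 0 <= t <= T -> clamp T t = t.
Proof. intros H. unfold clamp. rewrite Rmin_left, Rmax_right by lra. reflexivity. Qed.

Lemma clamp_range (T t : R) : 0 <= T -> 0 <= clamp T t <= T.
Proof.
  intros HT. unfold clamp. split; [apply Rmax_l |].
  apply Rmax_lub; [exact HT | apply Rmin_r].
Qed.

Lemma clamp_lipschitz (T t t' : R) : Rabs (clamp T t - clamp T t') <= Rabs (t - t').
Proof.
  unfold clamp, Rmax, Rmin.
  destruct (Rle_dec t T), (Rle_dec t' T);
    repeat match goal with |- context [Rle_dec 0 ?a] => destruct (Rle_dec 0 a) end;
    unfold Rabs; repeat destruct Rcase_abs; lra.
Qed.

Lemma clamp_continuous (T t : R) : continuous (clamp T) t.
Proof.
  apply filterlim_locally. intros eps. exists eps. intros t' Ht'.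
  eapply Rle_lt_trans; [apply clamp_lipschitz | exact Ht'].
Qed.

Lemma Derive_n_periodic (f : R -> R) (n : nat) : periodic f -> periodic (Derive_n f n).
Proof.
  intros Hf x. rewrite <- (Derive_n_comp_trans f n x (2 * PI)).
  apply Derive_n_ext. exact Hf.
Qed.

(** Composing with the continuous map [clamp] turns continuity relative to the closed strip into
    continuity on the plane. At interior times [clamp] is locally the identity, so the equation
    survives. *)
Lemma classical_solution_jet (alpha beta gamma T : R) (u0 : R -> R) (u : R -> R -> R) :
  0 < T -> classical_solution alpha beta gamma T u0 u ->
  solution_jet alpha beta gamma T u0 (fun j t => Derive_n (u (clamp T t)) j).
Proof.
  intros HT [Hper Hinit Hdt Hdx Hcont Heq].
  assert (HT' : 0 <= T) by lra.
  split.
  - intros j Hj p.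
    set (h := fun q : R * R => (clamp T (fst q), snd q)).
    apply (filterlim_comp _ _ _ h
             (fun q : R * R => Derive_n (u (fst q)) j (snd q)) _
             (within (fun q => 0 <= fst q <= T) (locally (h p)))).
    + intros P HP. unfold within in HP.
      assert (Hh : continuous h p).
      { apply (continuous_comp_2 (fun q : R * R => clamp T (fst q)) snd pair).
        - apply (continuous_comp fst (clamp T)); [destruct p; apply continuous_fst |].
          apply clamp_continuous.
        - destruct p; apply continuous_snd.
        - destruct p as [a b]. apply (continuous_ext (fun q => q)).
          + intros [c d]; reflexivity.
          + apply continuous_id. }
      apply Hh in HP. unfold filtermap in *.
      apply filter_imp with (2 := HP). intros q Hq. apply Hq, clamp_range, HT'.
    + refine (Hcont j Hj (h p) _). apply clamp_range, HT'.
  - intros j t. apply Derive_n_periodic, Hper, clamp_range, HT'.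
  - intros j t x Hj. apply (Derive_correct (Derive_n (u (clamp T t)) j)).
    apply (Hdx (S j)); [lia | apply clamp_range, HT'].
  - intros t x Ht. simpl (Derive_n _ 0).
    rewrite (clamp_id T t) by lra.
    apply is_derive_ext_loc with (fun z => u z x).
    + assert (Hloc : locally t (fun tau => 0 < tau < T)).
      { apply (open_and (fun tau => 0 < tau) (fun tau => tau < T));
          [apply open_gt | apply open_lt | exact Ht]. }
      apply filter_imp with (2 := Hloc). intros z Hz. rewrite clamp_id by lra.
      reflexivity.
    + assert (Ht' : 0 <= t <= T) by lra.
      replace (- _) with (Derive (fun tau => u tau x) t).
      * apply Derive_correct, Hdt, Ht'.
      * specialize (Heq t x Ht').
        assert (Hsq : Derive (fun y => u t y ^ 2) x = 2 * (u t x * Derive_n (u t) 1 x)).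
        { apply is_derive_unique.
          assert (H1 : is_derive (u t) x (Derive (u t) x))
            by (apply Derive_correct, (Hdx 1%nat); [lia | exact Ht']).
          auto_derive; [exists (Derive (u t) x); exact H1 |].
          simpl Derive_n. change (Derive (fun y => u t y) x) with (Derive (u t) x). ring. }
        rewrite Hsq in Heq. lra.
  - intros x. rewrite clamp_id by lra. apply Hinit.
Qed.

Section Balance.

Variables (alpha beta gamma T : R) (u0 : R -> R) (w : nat -> R -> R -> R).
Hypothesis Hw : solution_jet alpha beta gamma T u0 w.

(** The free evolution multiplies the mode [k] by [exp(- i t dispersion k)], so
    [cos(k x - dispersion k t)] solves the linear equation. *)
Definition dispersion (k : Z) : R := alpha * IZR k ^ 5 - beta * IZR k ^ 3.

Ltac jet_tac :=
  match goal with
  | |- jointly_continuous _ =>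
      jointly_continuous_tac; refine (jet_continuous _ _ _ _ _ _ Hw _ _); lia
  end.

(** Multiplied by [2 u], each of the three terms of the equation is an exact space derivative; the
    flux given below is the sum of their primitives. *)
Lemma energy_derive (t : R) :
  0 < t < T -> is_derive (fun tau => mean (fun x => w 0%nat tau x ^ 2)) t 0.
Proof.
  intros Ht.
  replace 0 with (mean (fun _ => 0)).
  2:{ unfold mean. rewrite RInt_const. change scal with Rmult. simpl. ring. }
  apply (mean_balance (fun t x => w 0%nat t x ^ 2) (fun _ _ => 0)
    (fun t x => - (2 * alpha * (w 0%nat t x * w 4%nat t x - w 1%nat t x * w 3%nat t x
                                + / 2 * w 2%nat t x ^ 2)
                   + 2 * beta * (w 0%nat t x * w 2%nat t x - / 2 * w 1%nat t x ^ 2)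
                   + 4 / 3 * gamma * w 0%nat t x ^ 3))
    (fun t x => - (2 * alpha * (w 0%nat t x * w 5%nat t x)
                   + 2 * beta * (w 0%nat t x * w 3%nat t x)
                   + 4 * gamma * (w 0%nat t x ^ 2 * w 1%nat t x))) T);
    try exact Ht; try jet_tac.
  - intros tau x Htau. pose proof (jet_dt _ _ _ _ _ _ Hw tau x Htau) as H.
    evar_last; [apply (is_derive_pow (fun z => w 0%nat z x) 2 tau _ H) |].
    simpl. ring.
  - intros tau x.
    pose proof (jet_dx _ _ _ _ _ _ Hw 0%nat tau x ltac:(lia)) as H0.
    pose proof (jet_dx _ _ _ _ _ _ Hw 1%nat tau x ltac:(lia)) as H1.
    pose proof (jet_dx _ _ _ _ _ _ Hw 2%nat tau x ltac:(lia)) as H2.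
    pose proof (jet_dx _ _ _ _ _ _ Hw 3%nat tau x ltac:(lia)) as H3.
    pose proof (jet_dx _ _ _ _ _ _ Hw 4%nat tau x ltac:(lia)) as H4.
    auto_derive; [repeat split; eexists; eassumption |].
    rewrite (is_derive_unique (fun y : R => w 0%nat tau y) _ _ H0),
      (is_derive_unique (fun y : R => w 1%nat tau y) _ _ H1),
      (is_derive_unique (fun y : R => w 2%nat tau y) _ _ H2),
      (is_derive_unique (fun y : R => w 3%nat tau y) _ _ H3),
      (is_derive_unique (fun y : R => w 4%nat tau y) _ _ H4). field.
  - intros tau x. rewrite !(jet_periodic _ _ _ _ _ _ Hw _ tau x). reflexivity.
Qed.

(** The solution is tested against a free wave. Integration by parts moves the linear operator onto
    the wave, where it cancels the time derivative; only the nonlinearity remains, with its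
    derivative moved onto the cosine. *)
Lemma oscillation_derive (k : Z) (c t : R) :
  0 < t < T ->
  is_derive
    (fun tau => mean (fun x => w 0%nat tau x * cos (IZR k * x + (c - dispersion k * tau))))
    t
    (mean (fun x => - (gamma * IZR k) *
       (w 0%nat t x ^ 2 * sin (IZR k * x + (c - dispersion k * t))))).
Proof.
  intros Ht.
  set (q := IZR k). set (om := dispersion k).
  set (C := fun t x => cos (q * x + (c - om * t))).
  set (S := fun t x => sin (q * x + (c - om * t))).
  assert (HC : jointly_continuous C) by (unfold C; jointly_continuous_tac).
  assert (HS : jointly_continuous S) by (unfold S; jointly_continuous_tac).
  assert (HCx : forall t x, is_derive (C t) x (- q * S t x)).
  { intros. unfold C, S. auto_derive; [easy | ring]. }
  assert (HSx : forall t x, is_derive (S t) x (q * C t x)).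
  { intros. unfold C, S. auto_derive; [easy | ring]. }
  assert (HCp : forall t, periodic (C t)) by (intros; apply periodic_cos_IZR).
  assert (HSp : forall t, periodic (S t)).
  { intros tau x. unfold S. rewrite <- !(cos_shift (q * _ + _)).
    pose proof (periodic_cos_IZR (- k) (PI / 2 - (c - om * tau)) x) as H.
    rewrite opp_IZR in H. fold q in H.
    replace (PI / 2 - (q * (x + 2 * PI) + (c - om * tau)))
      with (- q * (x + 2 * PI) + (PI / 2 - (c - om * tau))) by ring.
    rewrite H. f_equal. ring. }
  apply (mean_balance (fun t x => w 0%nat t x * C t x)
    (fun t x => - (gamma * q) * (w 0%nat t x ^ 2 * S t x))
    (fun t x => - (alpha * (w 4%nat t x * C t x + q * (w 3%nat t x * S t x)
                            - q ^ 2 * (w 2%nat t x * C t x)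
                            - q ^ 3 * (w 1%nat t x * S t x)
                            + q ^ 4 * (w 0%nat t x * C t x))
                   + beta * (w 2%nat t x * C t x + q * (w 1%nat t x * S t x)
                             - q ^ 2 * (w 0%nat t x * C t x))
                   + gamma * (w 0%nat t x ^ 2 * C t x)))
    (fun t x => - (alpha * (w 5%nat t x * C t x - q ^ 5 * (w 0%nat t x * S t x))
                   + beta * (w 3%nat t x * C t x + q ^ 3 * (w 0%nat t x * S t x))
                   + gamma * (2 * (w 0%nat t x * w 1%nat t x) * C t x
                              - q * (w 0%nat t x ^ 2 * S t x)))) T);
    try exact Ht; try jet_tac.
  - intros tau x Htau. pose proof (jet_dt _ _ _ _ _ _ Hw tau x Htau) as H.
    assert (HCt : is_derive (fun z => C z x) tau (om * S tau x)).
    { unfold C, S. auto_derive; [easy | unfold Rminus; ring]. }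
    evar_last.
    + apply (is_derive_mult (fun z => w 0%nat z x) (fun z => C z x) tau _ _ H HCt).
      intros; apply Rmult_comm.
    + change plus with Rplus. change mult with Rmult.
      unfold om, dispersion. fold q. ring.
  - intros tau x.
    pose proof (jet_dx _ _ _ _ _ _ Hw 0%nat tau x ltac:(lia)) as H0.
    pose proof (jet_dx _ _ _ _ _ _ Hw 1%nat tau x ltac:(lia)) as H1.
    pose proof (jet_dx _ _ _ _ _ _ Hw 2%nat tau x ltac:(lia)) as H2.
    pose proof (jet_dx _ _ _ _ _ _ Hw 3%nat tau x ltac:(lia)) as H3.
    pose proof (jet_dx _ _ _ _ _ _ Hw 4%nat tau x ltac:(lia)) as H4.
    pose proof (HCx tau x) as H5. pose proof (HSx tau x) as H6.
    clearbody C S.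
    auto_derive; [repeat split; eexists; eassumption |].
    rewrite (is_derive_unique (fun y : R => w 0%nat tau y) _ _ H0),
      (is_derive_unique (fun y : R => w 1%nat tau y) _ _ H1),
      (is_derive_unique (fun y : R => w 2%nat tau y) _ _ H2),
      (is_derive_unique (fun y : R => w 3%nat tau y) _ _ H3),
      (is_derive_unique (fun y : R => w 4%nat tau y) _ _ H4),
      (is_derive_unique (fun y : R => C tau y) _ _ H5),
      (is_derive_unique (fun y : R => S tau y) _ _ H6). ring.
  - intros tau x. rewrite !(jet_periodic _ _ _ _ _ _ Hw _ tau x), (HCp tau x), (HSp tau x).
    reflexivity.
Qed.

End Balance.

(** * Expansion of the solution in the amplitude *)


Lemma continuous_of_jointly_continuous (f : R -> R) :
  jointly_continuous (fun _ => f) -> forall x, continuous f x.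
Proof. intros Hf x. apply (jointly_continuous_snd (fun _ => f) 0 x Hf). Qed.

Lemma jointly_continuous_of_continuous (f : R -> R) :
  (forall x, continuous f x) -> jointly_continuous (fun _ => f).
Proof.
  intros Hf p. apply (continuous_comp (fun q : R * R => snd q) f).
  - apply jointly_continuous_space.
  - apply Hf.
Qed.

Ltac continuous_tac :=
  apply continuous_of_jointly_continuous; jointly_continuous_tac.

(** This is the real part of [exp(- i c)] times the Fourier coefficient at [k]; varying the phase
    recovers the complex mode from real averages. *)
Definition osc (f : R -> R) (k : Z) (c : R) : R :=
  mean (fun x => f x * cos (IZR k * x + c)).

Lemma cos_minus_PI2 (z : R) : cos (z - PI / 2) = sin z.
Proof. rewrite <- cos_shift, <- cos_neg. f_equal. ring. Qed.

Lemma Rabs_mean_sin_le (f : R -> R) (k : Z) (c : R) :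
  (forall x, continuous f x) -> (forall x, 0 <= f x) ->
  Rabs (mean (fun x => f x * sin (IZR k * x + c))) <= mean f.
Proof.
  intros Hf Hpos. pose proof (jointly_continuous_of_continuous f Hf) as Hf'.
  apply Rabs_mean_le; [continuous_tac | exact Hf |].
  intros x. rewrite Rabs_mult, (Rabs_pos_eq (f x)) by apply Hpos.
  rewrite <- (Rmult_1_r (f x)) at 2. apply Rmult_le_compat_l; [apply Hpos |].
  apply Rabs_le. pose proof (SIN_bound (IZR k * x + c)). lra.
Qed.

(** * The square of a function close to a plane wave *)

Section Interaction.

Variables (f : R -> R) (N : Z) (a h : R).
Hypothesis Hf : forall x, continuous f x.
Hypothesis HN : (0 < N)%Z.
Hypothesis Henergy : mean (fun x => f x ^ 2) = 2 * h ^ 2.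

Let v (x : R) : R := f x - 2 * h * cos (IZR N * x - a).

Let Hf' : jointly_continuous (fun _ => f) := jointly_continuous_of_continuous f Hf.

Let Hv : jointly_continuous (fun _ => v).
Proof. unfold v. jointly_continuous_tac. Qed.

(** Expanding the square, the energy of [f] and that of the wave are both [2 h^2], and the cross
    term is the mode [N] of [f]. Control of this one mode thus controls the whole defect. *)
Lemma mean_defect_sq : mean (fun x => v x ^ 2) = 4 * h * (h - osc f N (- a)).
Proof.
  rewrite (mean_ext _ (fun x => f x ^ 2 + (- 4 * h * (f x * cos (IZR N * x + - a))
     + (2 * h ^ 2 * cos (IZR 0 * x + 0) + 2 * h ^ 2 * cos (IZR (2 * N) * x + - 2 * a))))).
  - rewrite !mean_plus, !mean_scal by continuous_tac.
    rewrite Henergy, !mean_cos. destruct (Z.eq_dec 0 0); [| lia].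
    destruct (Z.eq_dec (2 * N) 0); [lia |]. rewrite cos_0. unfold osc. ring.
  - intros x. unfold v. rewrite mult_IZR.
    replace (2 * IZR N * x + - 2 * a) with (2 * (IZR N * x + - a)) by ring.
    rewrite cos_2a_cos. replace (0 * x + 0) with 0 by ring. rewrite cos_0.
    unfold Rminus. ring.
Qed.

(** With [y = N x - a], the square is [f^2 = 4 h f cos y - 4 h^2 cos^2 y + v^2]. The first term
    shifts the frequency [k] by [N] either way, the second has nonzero average against the sine only
    at [k = 2 N], and the third costs at most the average of [v^2]. Sines are written as cosines
    with phase lowered by [PI / 2] to fit [osc]. *)
Lemma quadratic_interaction (k : Z) (c : R) : (0 < k)%Z ->
  Rabs (mean (fun x => f x ^ 2 * sin (IZR k * x + c))
        - (2 * h * (osc f (k + N) (c - a - PI / 2) + osc f (k - N) (c + a - PI / 2))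
           - h ^ 2 * (if Z.eq_dec (k - 2 * N) 0 then sin (c + 2 * a) else 0)))
  <= 4 * h * (h - osc f N (- a)).
Proof.
  intros Hk. rewrite <- mean_defect_sq.
  rewrite (mean_ext (fun x => f x ^ 2 * sin (IZR k * x + c)) (fun x =>
     2 * h * (f x * cos (IZR (k + N) * x + (c - a - PI / 2)))
     + (2 * h * (f x * cos (IZR (k - N) * x + (c + a - PI / 2)))
     + (- h ^ 2 * cos (IZR (k + 2 * N) * x + (c - 2 * a - PI / 2))
     + (- h ^ 2 * cos (IZR (k - 2 * N) * x + (c + 2 * a - PI / 2))
     + (- (2 * h ^ 2) * cos (IZR k * x + (c - PI / 2))
     + v x ^ 2 * sin (IZR k * x + c))))))).
  - rewrite !mean_plus, !mean_scal, !mean_cos by continuous_tac.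
    fold (osc f (k + N) (c - a - PI / 2)). fold (osc f (k - N) (c + a - PI / 2)).
    destruct (Z.eq_dec (k + 2 * N) 0); [lia |]. destruct (Z.eq_dec k 0); [lia |].
    rewrite cos_minus_PI2.
    match goal with |- Rabs ?z <= _ =>
      replace z with (mean (fun x => v x ^ 2 * sin (IZR k * x + c)))
        by (destruct (Z.eq_dec (k - 2 * N) 0); ring) end.
    apply (Rabs_mean_sin_le (fun x => v x ^ 2)).
    + continuous_tac.
    + intros x. apply pow2_ge_0.
  - intros x. unfold v. rewrite !plus_IZR, !minus_IZR, !mult_IZR.
    set (A := IZR k * x + c). set (y := IZR N * x - a).
    replace ((IZR k + IZR N) * x + (c - a - PI / 2)) with (A + y - PI / 2)
      by (unfold A, y; ring).
    replace ((IZR k - IZR N) * x + (c + a - PI / 2)) with (A - y - PI / 2)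
      by (unfold A, y; ring).
    replace ((IZR k + 2 * IZR N) * x + (c - 2 * a - PI / 2)) with (A + 2 * y - PI / 2)
      by (unfold A, y; ring).
    replace ((IZR k - 2 * IZR N) * x + (c + 2 * a - PI / 2)) with (A - 2 * y - PI / 2)
      by (unfold A, y; ring).
    replace (IZR k * x + (c - PI / 2)) with (A - PI / 2) by (unfold A; ring).
    rewrite !cos_minus_PI2, !sin_plus, !sin_minus, !cos_2a_cos. ring.
Qed.

End Interaction.

(** * Bootstrapping the modes of the solution with data [2 h cos(N x)] *)

Section Expansion.

Variables (alpha beta gamma T : R) (N : Z) (h : R) (w : nat -> R -> R -> R).
Hypothesis HT : 0 < T.
Hypothesis HN : (0 < N)%Z.
Hypothesis Hh : 0 <= h.
Hypothesis Hw :
  solution_jet alpha beta gamma T (fun x => 2 * h * cos (IZR N * x)) w.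

Let om := dispersion alpha beta.

(* The mode [k] with its free evolution removed; c = 0 and c = PI / 2 give the real and
   imaginary parts. *)
Definition profile (k : Z) (c t : R) : R :=
  osc (w 0%nat t) k (c - dispersion alpha beta k * t).

Let Hw0 : jointly_continuous (w 0%nat).
Proof. apply (jet_continuous _ _ _ _ _ _ Hw). lia. Qed.

Let Hw0' (t x : R) : continuous (w 0%nat t) x.
Proof. apply jointly_continuous_snd, Hw0. Qed.

Lemma osc_profile (k : Z) (c t : R) : osc (w 0%nat t) k c = profile k (c + om k * t) t.
Proof. unfold profile. f_equal. unfold om. ring. Qed.

Lemma profile_initial (k : Z) (c : R) : (0 <= k)%Z ->
  profile k c 0 = if Z.eq_dec k N then h * cos c else 0.
Proof.
  intros Hk. unfold profile, osc. rewrite Rmult_0_r, Rminus_0_r.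
  rewrite (mean_ext _ (fun x => h * cos (IZR (k - N) * x + c)
                                + h * cos (IZR (k + N) * x + c))).
  - rewrite mean_plus, !mean_scal, !mean_cos by continuous_tac.
    destruct (Z.eq_dec (k + N) 0); [lia |].
    destruct (Z.eq_dec (k - N) 0), (Z.eq_dec k N); try lia; ring.
  - intros x. rewrite (jet_initial _ _ _ _ _ _ Hw), minus_IZR, plus_IZR.
    replace ((IZR k - IZR N) * x + c) with (IZR k * x + c - IZR N * x) by ring.
    replace ((IZR k + IZR N) * x + c) with (IZR k * x + c + IZR N * x) by ring.
    set (b := IZR k * x + c). rewrite cos_minus, cos_plus. ring.
Qed.

Lemma energy_conserved (t : R) : 0 <= t <= T -> mean (fun x => w 0%nat t x ^ 2) = 2 * h ^ 2.
Proof.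
  intros Ht.
  assert (H0 : mean (fun x => w 0%nat 0 x ^ 2) = 2 * h ^ 2).
  { rewrite (mean_ext _ (fun x => 2 * h ^ 2 * cos (IZR 0 * x + 0)
                                  + 2 * h ^ 2 * cos (IZR (2 * N) * x + 0))).
    - rewrite mean_plus, !mean_scal, !mean_cos by continuous_tac.
      destruct (Z.eq_dec 0 0); [| lia]. destruct (Z.eq_dec (2 * N) 0); [lia |].
      rewrite cos_0. ring.
    - intros x. rewrite (jet_initial _ _ _ _ _ _ Hw), mult_IZR.
      replace (2 * IZR N * x + 0) with (2 * (IZR N * x)) by ring.
      replace (0 * x + 0) with 0 by ring. rewrite cos_2a_cos, cos_0. ring. }
  assert (H : Rabs (mean (fun x => w 0%nat t x ^ 2) - mean (fun x => w 0%nat 0 x ^ 2)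
                    - (0 - 0)) <= 0 * t).
  { apply (increment_bound (fun tau => mean (fun x => w 0%nat tau x ^ 2)) (fun _ => 0)
             (fun _ => 0) (fun _ => 0) T).
    - intros x. apply (mean_param_continuous (fun tau x => w 0%nat tau x ^ 2)).
      jointly_continuous_tac.
    - intros x Hx. apply (energy_derive _ _ _ _ _ _ Hw x Hx).
    - intros x. apply (is_derive_const (V := R_NormedModule)).
    - intros x _. rewrite Rminus_0_r, Rabs_R0. lra.
    - exact Ht. }
  rewrite Rmult_0_l in H. pose proof (Rabs_pos (mean (fun x => w 0%nat t x ^ 2)
    - mean (fun x => w 0%nat 0 x ^ 2) - (0 - 0))) as H'.
  apply Rle_antisym in H; [| exact H'].
  symmetry in H. apply Rabs_eq_0 in H. lra.
Qed.

(** Duhamel's formula for one mode: an approximation [de] of the interaction up to [K] yields an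
    approximation of the profile. Each order of the expansion feeds the previous one into it. *)
Lemma profile_step (k : Z) (c t K : R) (e de : R -> R) :
  (0 <= k)%Z -> 0 <= t <= T ->
  (forall x, is_derive e x (- (gamma * IZR k) * de x)) ->
  (forall tau, 0 < tau < T ->
     Rabs (mean (fun x => w 0%nat tau x ^ 2 * sin (IZR k * x + (c - om k * tau))) - de tau)
     <= K) ->
  Rabs (profile k c t - profile k c 0 - (e t - e 0)) <= Rabs gamma * IZR k * K * T.
Proof.
  intros Hk Ht He HK.
  assert (Hk' : 0 <= IZR k) by (apply IZR_le, Hk).
  assert (HK0 : 0 <= K).
  { eapply Rle_trans; [apply Rabs_pos | apply (HK (T / 2)); lra]. }
  apply Rle_trans with (Rabs gamma * IZR k * K * t).
  2:{ apply Rmult_le_compat_l; [| lra].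
      repeat apply Rmult_le_pos; try assumption. apply Rabs_pos. }
  apply (increment_bound (profile k c)
    (fun tau => - (gamma * IZR k) *
       mean (fun x => w 0%nat tau x ^ 2 * sin (IZR k * x + (c - om k * tau))))
    e (fun x => - (gamma * IZR k) * de x) T); try assumption.
  - intros tau.
    apply (mean_param_continuous (fun tau x =>
      w 0%nat tau x * cos (IZR k * x + (c - dispersion alpha beta k * tau)))).
    jointly_continuous_tac.
  - intros tau Htau. rewrite <- mean_scal.
    + apply (oscillation_derive _ _ _ _ _ _ Hw k c tau Htau).
    + pose proof (jointly_continuous_of_continuous _ (Hw0' tau)). continuous_tac.
  - intros tau Htau. rewrite <- Rmult_minus_distr_l, Rabs_mult, Rabs_Ropp, Rabs_mult.
    rewrite (Rabs_pos_eq (IZR k)) by exact Hk'.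
    apply Rmult_le_compat_l; [| apply HK, Htau].
    apply Rmult_le_pos; [apply Rabs_pos | exact Hk'].
Qed.

Let A := 2 * Rabs gamma * IZR N * T.

Let HA : 0 <= A.
Proof.
  unfold A. apply Rmult_le_pos; [| lra].
  apply Rmult_le_pos; [| apply IZR_le; lia].
  pose proof (Rabs_pos gamma). lra.
Qed.

(** The interaction is bounded crudely by the conserved energy [2 h^2]. For [m = 0] the bound
    vanishes, so the solution keeps mean zero. *)
Lemma profile_first_order (m : Z) (c t : R) : (0 <= m)%Z -> 0 <= t <= T ->
  Rabs (profile (m * N) c t - (if Z.eq_dec m 1 then h * cos c else 0)) <= IZR m * A * h ^ 2.
Proof.
  intros Hm Ht.
  assert (H := profile_step (m * N) c t (2 * h ^ 2) (fun _ => 0) (fun _ => 0)).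
  rewrite profile_initial in H by nia.
  replace (if Z.eq_dec (m * N) N then h * cos c else 0)
    with (if Z.eq_dec m 1 then h * cos c else 0) in H
    by (destruct (Z.eq_dec m 1), (Z.eq_dec (m * N) N); try reflexivity; nia).
  rewrite !Rminus_0_r in H.
  eapply Rle_trans; [apply H |].
  - nia.
  - exact Ht.
  - intros x. rewrite Rmult_0_r. apply (is_derive_const (V := R_NormedModule)).
  - intros tau Htau. rewrite Rminus_0_r, <- (energy_conserved tau) by lra.
    apply (Rabs_mean_sin_le (fun x => w 0%nat tau x ^ 2)).
    + pose proof (jointly_continuous_of_continuous _ (Hw0' tau)). continuous_tac.
    + intros x. apply pow2_ge_0.
  - rewrite mult_IZR. unfold A. right. ring.
Qed.

(** The wave subtracted is the free evolution of the data, hence the phase [om N * t]. Passing from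
    modes to profiles turns the phases into the frequency mismatches of the interactions. *)
Lemma profile_interaction (k : Z) (c t : R) : (0 < k)%Z -> 0 <= t <= T ->
  Rabs (mean (fun x => w 0%nat t x ^ 2 * sin (IZR k * x + (c - om k * t)))
     - (2 * h * (profile (k + N) (c - PI / 2 + (om (k + N)%Z - om k - om N) * t) t
                 + profile (k - N) (c - PI / 2 + (om (k - N)%Z - om k + om N) * t) t)
        - h ^ 2 * (if Z.eq_dec (k - 2 * N) 0
                   then sin (c - (om k - 2 * om N) * t) else 0)))
  <= 4 * h * (h - profile N 0 t).
Proof.
  intros Hk Ht.
  pose proof (quadratic_interaction (w 0%nat t) N (om N * t) h (Hw0' t) HN
                (energy_conserved t Ht) k (c - om k * t) Hk) as H.
  rewrite !osc_profile in H.
  replace (- (om N * t) + om N * t) with 0 in H by ring.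
  replace (c - om k * t + 2 * (om N * t)) with (c - (om k - 2 * om N) * t) in H by ring.
  replace (c - om k * t - om N * t - PI / 2 + om (k + N)%Z * t)
    with (c - PI / 2 + (om (k + N)%Z - om k - om N) * t) in H by ring.
  replace (c - om k * t + om N * t - PI / 2 + om (k - N)%Z * t)
    with (c - PI / 2 + (om (k - N)%Z - om k + om N) * t) in H by ring.
  exact H.
Qed.

Let D := om (2 * N)%Z - 2 * om N.
Hypothesis HD : D <> 0.

(** At frequency [2 N] the mode [N] contributes [2 h^2 sin(c - D t)] to leading order and the square
    of the wave takes back half of it; integrating what is left in time produces the division by
    [D]. *)
Lemma profile_double (c t : R) : 0 <= t <= T ->
  Rabs (profile (2 * N) c t + 2 * gamma * IZR N * h ^ 2 / D * (cos (c - D * t) - cos c))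
  <= 12 * A ^ 2 * h ^ 3.
Proof.
  intros Ht.
  (* The constant is 12 = 6 + 2 + 4: the mode [3 N], the first-order error of the mode [N], and the
     defect. *)
  assert (H := profile_step (2 * N) c t (12 * A * h ^ 3)
    (fun tau => - (2 * gamma * IZR N * h ^ 2 / D) * cos (c - D * tau))
    (fun tau => h ^ 2 * sin (c - D * tau))).
  rewrite profile_initial in H by lia.
  destruct (Z.eq_dec (2 * N) N); [lia |].
  rewrite Rmult_0_r, !Rminus_0_r in H.
  match type of H with _ -> _ -> _ -> _ -> Rabs ?x <= ?y =>
    match goal with |- Rabs ?x' <= ?y' =>
      replace x' with x by ring; replace y' with y end end.
  2:{ rewrite mult_IZR. unfold A. ring. }
  apply H; [lia | exact Ht | |].
  - intros x. rewrite mult_IZR. auto_derive; [easy |]. unfold Rminus. field. exact HD.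
  - intros tau Htau.
    assert (Htau' : 0 <= tau <= T) by lra.
    pose proof (profile_interaction (2 * N) c tau ltac:(lia) Htau') as H1.
    destruct (Z.eq_dec (2 * N - 2 * N) 0); [| lia].
    replace (2 * N + N)%Z with (3 * N)%Z in H1 by ring.
    replace (2 * N - N)%Z with (1 * N)%Z in H1 by ring.
    set (c3 := c - PI / 2 + (om (3 * N)%Z - om (2 * N)%Z - om N) * tau) in H1.
    replace (c - PI / 2 + (om (1 * N)%Z - om (2 * N)%Z + om N) * tau)
      with (c - D * tau - PI / 2) in H1 by (rewrite Z.mul_1_l; unfold D; ring).
    fold D in H1.
    pose proof (profile_first_order 3 c3 tau ltac:(lia) Htau') as H2.
    pose proof (profile_first_order 1 (c - D * tau - PI / 2) tau ltac:(lia) Htau') as H3.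
    pose proof (profile_first_order 1 0 tau ltac:(lia) Htau') as H4.
    simpl Z.eq_dec in H2, H3, H4. cbv iota in H2, H3, H4.
    rewrite cos_minus_PI2 in H3. rewrite cos_0 in H4.
    rewrite (Z.mul_1_l N) in H4.
    set (M := mean _) in *. set (p3 := profile (3 * N) _ _) in *.
    set (p1 := profile (1 * N) _ _) in *. set (p0 := profile N 0 tau) in *.
    set (s := sin (c - D * tau)) in *.
    apply Rabs_le_between in H1, H2, H3, H4. apply Rabs_le.
    clearbody M p3 p1 p0 s A. nra.
Qed.

Lemma fundamental_interaction (c t : R) : 0 <= t <= T ->
  Rabs (mean (fun x => w 0%nat t x ^ 2 * sin (IZR N * x + (c - om N * t)))
        - 2 * h * profile (2 * N) (c - PI / 2 + D * t) t)
  <= 4 * h * (h - profile N 0 t).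
Proof.
  intros Ht. pose proof (profile_interaction N c t HN Ht) as H.
  destruct (Z.eq_dec (N - 2 * N) 0); [lia |].
  replace (N + N)%Z with (2 * N)%Z in H by ring.
  replace (N - N)%Z with (0 * N)%Z in H by ring.
  (* The mode [k - N] is now the mean of the solution, which the first-order bound with [m = 0]
     forces to be zero. *)
  pose proof (profile_first_order 0 (c - PI / 2 + (om (0 * N)%Z - om N + om N) * t) t
                ltac:(lia) Ht) as H0.
  simpl Z.eq_dec in H0. cbv iota in H0. rewrite !Rmult_0_l, Rminus_0_r in H0.
  apply Rabs_le_between in H0.
  set (p0 := profile (0 * N) _ _) in *.
  replace p0 with 0 in H by lra.
  replace (om (2 * N)%Z - om N - om N) with D in H by (unfold D; ring).
  rewrite Rplus_0_r, Rmult_0_r, Rminus_0_r in H. exact H.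
Qed.

(** The mode [N] is fed only by the mode [2 N], itself [O(h^2)], and by the defect, so it moves by
    [O(h^3)]. This improves the defect to [O(h^4)] for the next order. *)
Lemma profile_second_order (c t : R) : 0 <= t <= T ->
  Rabs (profile N c t - h * cos c) <= 4 * A ^ 2 * h ^ 3.
Proof.
  intros Ht.
  (* Here 8 = 4 + 4, from the mode [2 N] and from the defect, each bounded at first order. *)
  assert (H := profile_step N c t (8 * A * h ^ 3) (fun _ => 0) (fun _ => 0)).
  rewrite profile_initial in H by lia.
  destruct (Z.eq_dec N N); [| lia].
  rewrite !Rminus_0_r in H.
  replace (4 * A ^ 2 * h ^ 3) with (Rabs gamma * IZR N * (8 * A * h ^ 3) * T)
    by (unfold A; ring).
  apply H; [lia | exact Ht | |].
  - intros x. rewrite Rmult_0_r. apply (is_derive_const (V := R_NormedModule)).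
  - intros tau Htau. rewrite Rminus_0_r.
    assert (Htau' : 0 <= tau <= T) by lra.
    pose proof (fundamental_interaction c tau Htau') as H1.
    pose proof (profile_first_order 2 (c - PI / 2 + D * tau) tau ltac:(lia) Htau') as H2.
    pose proof (profile_first_order 1 0 tau ltac:(lia) Htau') as H3.
    simpl Z.eq_dec in H2, H3. cbv iota in H2, H3.
    rewrite (Z.mul_1_l N), cos_0 in H3.
    set (M := mean _) in *. set (p2 := profile (2 * N) _ _) in *.
    set (p0 := profile N 0 tau) in *.
    apply Rabs_le_between in H1, H2, H3. apply Rabs_le.
    clearbody M p2 p0 A. nra.
Qed.

(** The phase [PI / 2] selects the imaginary part, which starts at 0. The response of the mode [2 N]
    returns to [N] with a factor [1 - cos(D t)], whose constant part gives growth linear in [T]. *)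
Lemma profile_third_order :
  Rabs (profile N (PI / 2) T
        - 4 * gamma ^ 2 * IZR N ^ 2 / D * (T - sin (D * T) / D) * h ^ 3)
  <= 20 * A ^ 3 * h ^ 4.
Proof.
  (* Here 40 = 24 + 16: twice [h] times the error of [profile_double], and the defect bounded by
     [profile_second_order]. *)
  assert (H := profile_step N (PI / 2) T (40 * A ^ 2 * h ^ 4)
    (fun tau => 4 * gamma ^ 2 * IZR N ^ 2 / D * (tau - sin (D * tau) / D) * h ^ 3)
    (fun tau => - (4 * gamma * IZR N * h ^ 3 / D) * (1 - cos (D * tau)))).
  rewrite profile_initial in H by lia.
  destruct (Z.eq_dec N N); [| lia].
  rewrite cos_PI2, !Rmult_0_r, sin_0 in H.
  match type of H with _ -> _ -> _ -> _ -> Rabs ?x <= ?y =>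
    match goal with |- Rabs ?x' <= ?y' =>
      replace x' with x by (field; exact HD); replace y' with y by (unfold A; ring) end end.
  apply H; [lia | lra | |].
  - intros x. auto_derive; [easy |]. field. exact HD.
  - intros tau Htau.
    assert (Htau' : 0 <= tau <= T) by lra.
    pose proof (fundamental_interaction (PI / 2) tau Htau') as H1.
    replace (PI / 2 - PI / 2 + D * tau) with (D * tau) in H1 by ring.
    pose proof (profile_double (D * tau) tau Htau') as H2.
    rewrite Rminus_diag, cos_0 in H2.
    pose proof (profile_second_order 0 tau Htau') as H3.
    rewrite cos_0 in H3.
    set (M := mean _) in *. set (p2 := profile (2 * N) _ _) in *.
    set (p0 := profile N 0 tau) in *.
    replace (- (4 * gamma * IZR N * h ^ 3 / D) * (1 - cos (D * tau)))
      with (- (2 * h * (2 * gamma * IZR N * h ^ 2 / D * (1 - cos (D * tau)))))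
      by (field; exact HD).
    set (q := 2 * gamma * IZR N * h ^ 2 / D * (1 - cos (D * tau))) in *.
    apply Rabs_le_between in H1, H2, H3. apply Rabs_le.
    clearbody M p2 p0 q A. nra.
Qed.

End Expansion.

(** * Third differences of maps of class C^3 *)


Lemma forward_difference (g g' : R -> R) (a h : R) :
  0 <= h -> (forall z, is_derive g z (g' z)) ->
  exists c, a <= c <= a + h /\ g (a + h) - g a = h * g' c.
Proof.
  intros Hh Hg. destruct (MVT_gen g a (a + h) g') as [c [Hc Heq]].
  - intros x _. apply Hg.
  - intros x _. apply continuity_pt_filterlim, (ex_derive_continuous g).
    exists (g' x). apply Hg.
  - rewrite Rmin_left, Rmax_right in Hc by lra. exists c. split; [exact Hc |].
    rewrite Heq. ring.
Qed.

Lemma is_derive_shift (g g' : R -> R) (a z : R) :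
  (forall y, is_derive g y (g' y)) -> is_derive (fun y => g (y + a)) z (g' (z + a)).
Proof.
  intros Hg. rewrite <- (Rmult_1_l (g' (z + a))).
  apply (is_derive_comp g (fun y => y + a) z (g' (z + a)) 1); [apply Hg |].
  auto_derive; [easy | ring].
Qed.

(** Three applications of the mean value theorem, each trading one difference for one derivative;
    the last intermediate point lies between 0 and [3 h]. *)
Lemma third_difference_bound (g g1 g2 g3 : R -> R) (h B : R) :
  0 <= h ->
  (forall z, is_derive g z (g1 z)) -> (forall z, is_derive g1 z (g2 z)) ->
  (forall z, is_derive g2 z (g3 z)) ->
  (forall z, 0 <= z <= 3 * h -> Rabs (g3 z) <= B) ->
  Rabs (g (3 * h) - 3 * g (2 * h) + 3 * g h - g 0) <= B * h ^ 3.
Proof.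
  intros Hh H1 H2 H3 HB.
  destruct (forward_difference (fun z => g (z + 2 * h) - 2 * g (z + h) + g z)
    (fun z => g1 (z + 2 * h) - 2 * g1 (z + h) + g1 z) 0 h Hh) as [c1 [Hc1 E1]].
  { intros z. apply (is_derive_plus (fun z => g (z + 2 * h) - 2 * g (z + h)) g);
      [| apply H1].
    apply (is_derive_minus (fun z => g (z + 2 * h)) (fun z => 2 * g (z + h))).
    - apply is_derive_shift, H1.
    - apply (is_derive_scal (fun z => g (z + h))), is_derive_shift, H1. }
  destruct (forward_difference (fun z => g1 (z + h) - g1 z)
    (fun z => g2 (z + h) - g2 z) c1 h Hh) as [c2 [Hc2 E2]].
  { intros z. apply (is_derive_minus (fun z => g1 (z + h)) g1); [| apply H2].
    apply is_derive_shift, H2. }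
  destruct (forward_difference g2 g3 c2 h Hh H3) as [c3 [Hc3 E3]].
  replace (g (3 * h) - 3 * g (2 * h) + 3 * g h - g 0) with (g3 c3 * h ^ 3).
  - rewrite Rabs_mult, (Rabs_pos_eq (h ^ 3)) by (apply pow_le, Hh).
    apply Rmult_le_compat_r; [apply pow_le, Hh | apply HB; lra].
  - replace (g (3 * h) - 3 * g (2 * h) + 3 * g h - g 0)
      with (g (0 + h + 2 * h) - 2 * g (0 + h + h) + g (0 + h)
            - (g (0 + 2 * h) - 2 * g (0 + h) + g 0)).
    + rewrite E1.
      replace (g1 (c1 + 2 * h) - 2 * g1 (c1 + h) + g1 c1)
        with (g1 (c1 + h + h) - g1 (c1 + h) - (g1 (c1 + h) - g1 c1)).
      * rewrite E2, E3. ring.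
      * replace (c1 + h + h) with (c1 + 2 * h) by ring. ring.
    + replace (0 + h + 2 * h) with (3 * h) by ring.
      replace (0 + h + h) with (2 * h) by ring.
      replace (0 + 2 * h) with (2 * h) by ring. replace (0 + h) with h by ring. ring.
Qed.

(** The target [G] is arbitrary so that the lemma applies to the map and to its operator-valued
    derivatives alike. *)
Lemma is_derive_along_line {E G : NormedModule R_AbsRing} (F : E -> G)
    (dF : bounded_op E G) (l : G -> R) (phi : E) (z : R) :
  is_linear (V := R_NormedModule) l -> filterdiff F (locally (scal z phi)) dF ->
  is_derive (fun y => l (F (scal y phi))) z (l (dF phi)).
Proof.
  intros Hl HF. unfold is_derive.
  apply filterdiff_ext_lin with (fun y : R => l (dF (scal y phi))).
  - apply (filterdiff_comp' (U := AbsRing_NormedModule R_AbsRing)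
             (fun y : R => F (scal y phi)) l z
             (fun y => dF (scal y phi)) l).
    + apply (filterdiff_comp' (U := AbsRing_NormedModule R_AbsRing)
               (fun y : R => scal y phi) F z (fun y : R => scal y phi) dF).
      * apply filterdiff_linear. exact (is_linear_scal_l (K := R_AbsRing) phi).
      * exact HF.
    + apply filterdiff_linear, Hl.
  - intros y. rewrite (linear_scal dF (bop_linear _ _ dF)), (linear_scal l Hl).
    reflexivity.
Qed.

Lemma is_linear_evaluation {E G : NormedModule R_AbsRing} (l : G -> R) (phi : E) :
  is_linear (V := R_NormedModule) l ->
  is_linear (U := bop_NormedModule E G) (V := R_NormedModule) (fun m => l (bop_fun E G m phi)).
Proof.
  intros Hl. split.
  - intros x y. apply (linear_plus l Hl).
  - intros k x. apply (linear_scal l Hl).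
  - destruct (linear_norm l Hl) as [M [HM Hb]].
    (* The added 1 keeps the constant positive when [phi] has norm zero. *)
    exists (M * (norm phi + 1)). pose proof (norm_ge_0 phi) as Hphi. split; [nra |].
    intros x. eapply Rle_trans; [apply Hb |].
    pose proof (op_norm_bound E G x phi) as H. pose proof (op_norm_ge_0 E G x) as H0.
    change (M * norm (x phi) <= M * (norm phi + 1) * op_norm E G x). nra.
Qed.

(** The third derivative is continuous at 0, hence bounded by [1 + norm (f3 zero)] on a ball. The
    constants [K] and [delta] precede the choice of [l] and [phi], which lets the frequency vary
    later. *)
Lemma class_C_3_third_difference {E : NormedModule R_AbsRing} (f : E -> E) :
  class_C 3 f ->
  exists K delta : R, 0 < K /\ 0 < delta /\
    forall (l : E -> R) (M : R) (phi : E) (h : R),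
      is_linear (V := R_NormedModule) l -> (forall x, Rabs (l x) <= M * norm x) ->
      0 <= M -> 0 <= h -> 3 * h * norm phi < delta ->
      Rabs (l (f (scal (3 * h) phi)) - 3 * l (f (scal (2 * h) phi))
            + 3 * l (f (scal h phi)) - l (f (scal 0 phi)))
      <= M * K * norm phi ^ 3 * h ^ 3.
Proof.
  intros [f1 [Hf1 [f2 [Hf2 [f3 [Hf3 Hc]]]]]].
  pose proof (proj1 (filterlim_locally_ball_norm _ _) (Hc zero) (mkposreal 1 Rlt_0_1)) as Hb.
  destruct (locally_norm_le_locally (V := E) zero _ Hb) as [d Hd].
  set (E3 := bop_NormedModule E (bop_NormedModule E (bop_NormedModule E E))).
  exists (1 + norm (f3 zero : E3)), d.
  pose proof (norm_ge_0 (f3 zero : E3)) as H0.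
  split; [lra |]. split; [apply cond_pos |].
  assert (Hf3b : forall x, norm x < d -> norm (f3 x : E3) <= 1 + norm (f3 zero : E3)).
  { intros x Hx.
    assert (Hd' : ball_norm (V := E3) (f3 zero) 1 (f3 x)).
    { apply (Hd x). unfold ball_norm.
      eapply Rle_lt_trans with (2 := Hx). right. f_equal.
      apply (minus_zero_r (G := E)). }
    unfold ball_norm in Hd'.
    replace (f3 x : E3) with (plus (minus (f3 x : E3) (f3 zero)) (f3 zero : E3)).
    - eapply Rle_trans; [apply (norm_triangle (V := E3)) |].
      apply Rplus_le_compat_r. left. exact Hd'.
    - unfold minus. rewrite <- plus_assoc, plus_opp_l, plus_zero_r. reflexivity. }
  intros l M phi h Hl HM HM0 Hh Hsmall.
  pose proof (norm_ge_0 phi) as Hphi.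
  apply (third_difference_bound (fun z => l (f (scal z phi)))
    (fun z => l (f1 (scal z phi) phi))
    (fun z => l (bop_fun _ _ (f2 (scal z phi) phi) phi))
    (fun z => l (bop_fun _ _ (bop_fun _ _ (f3 (scal z phi) phi) phi) phi)) h _ Hh).
  - intros z. apply (is_derive_along_line f (f1 (scal z phi)) l phi z Hl), Hf1.
  - intros z. apply (is_derive_along_line f1 (f2 (scal z phi)) (fun m => l (m phi)) phi z).
    + apply is_linear_evaluation, Hl.
    + apply Hf2.
  - intros z. apply (is_derive_along_line f2 (f3 (scal z phi))
                       (fun m => l (bop_fun _ _ (bop_fun _ _ m phi) phi)) phi z).
    + apply (is_linear_evaluation (fun m : bop_NormedModule E E => l (m phi))).
      apply is_linear_evaluation, Hl.
    + apply Hf3.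
  - intros z Hz. eapply Rle_trans; [apply HM |].
    rewrite Rmult_assoc. apply Rmult_le_compat_l; [exact HM0 |].
    set (m := f3 (scal z phi)).
    assert (Hm : norm (m : E3) <= 1 + norm (f3 zero : E3)).
    { apply Hf3b. rewrite norm_scal_R, Rabs_pos_eq by lra.
      apply Rle_lt_trans with (2 := Hsmall). apply Rmult_le_compat_r; lra. }
    eapply Rle_trans; [apply op_norm_bound |].
    replace ((1 + norm (f3 zero : E3)) * norm phi ^ 3)
      with ((1 + norm (f3 zero : E3)) * norm phi * norm phi * norm phi) by ring.
    apply Rmult_le_compat_r; [exact Hphi |].
    eapply Rle_trans; [apply (op_norm_bound E (bop_NormedModule E E)) |].
    apply Rmult_le_compat_r; [exact Hphi |].
    eapply Rle_trans; [apply (op_norm_bound E (bop_NormedModule E (bop_NormedModule E E))) |].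
    apply Rmult_le_compat_r; [exact Hphi |]. exact Hm.
Qed.

(** * Plane waves and the contradiction *)


Lemma is_series_single (a : nat -> R) (n : nat) :
  (forall j, j <> n -> a j = 0) -> is_series a (a n).
Proof.
  intros Ha.
  assert (H0 : forall m, (m < n)%nat -> sum_n a m = 0).
  { induction m as [| m IH]; intros Hm.
    - rewrite sum_O. apply Ha. lia.
    - rewrite sum_Sn, IH, Ha by lia. apply Rplus_0_l. }
  assert (H1 : forall m, (n <= m)%nat -> sum_n a m = a n).
  { induction m as [| m IH]; intros Hm.
    - rewrite sum_O. f_equal. lia.
    - rewrite sum_Sn. destruct (Nat.eq_dec (S m) n) as [<- | Hn].
      + rewrite H0 by lia. apply Rplus_0_l.
      + rewrite IH, (Ha (S m)) by lia. apply Rplus_0_r. }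
  apply filterlim_ext_loc with (fun _ => a n).
  - exists n. intros m Hm. symmetry. apply H1, Hm.
  - apply filterlim_const.
Qed.

(** For positive [N], these are the Fourier coefficients of [2 cos(N x)]. *)
Definition wave_coef (N k : Z) : Complex.C :=
  if Z.eq_dec k N then RtoC 1 else if Z.eq_dec k (- N) then RtoC 1 else RtoC 0.

Lemma wave_sobolev (s : R) (N : Z) : (0 < N)%Z ->
  is_series (sobolev_term s (wave_coef N)) (2 * Rpower (japanese N) s ^ 2).
Proof.
  (* The term of index [n] gathers the frequencies [n + 1] and [-(n + 1)], so both modes of the wave
     sit at index [N - 1]. *)
  intros HN. set (n := Nat.pred (Z.to_nat N)).
  assert (Hn : Z.of_nat (S n) = N) by lia.
  assert (Hneg : japanese (- N) = japanese N).
  { unfold japanese. rewrite opp_IZR. f_equal. ring. }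
  replace (2 * Rpower (japanese N) s ^ 2) with (sobolev_term s (wave_coef N) n).
  - apply is_series_single. intros j Hj. unfold sobolev_term, weighted_sq, wave_coef.
    destruct (Z.eq_dec (Z.of_nat (S j)) N); [lia |].
    destruct (Z.eq_dec (Z.of_nat (S j)) (- N)); [lia |].
    destruct (Z.eq_dec (- Z.of_nat (S j)) N); [lia |].
    destruct (Z.eq_dec (- Z.of_nat (S j)) (- N)); [lia |].
    rewrite Cmod_0. ring.
  - unfold sobolev_term, weighted_sq. rewrite Hn, Hneg. unfold wave_coef.
    destruct (Z.eq_dec N N); [| lia]. destruct (Z.eq_dec (- N) N); [lia |].
    destruct (Z.eq_dec (- N) (- N)); [| lia]. rewrite Cmod_1. ring.
Qed.

Program Definition wave (s : R) (N : Z) (HN : (0 < N)%Z) : Hdot s :=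
  Build_Hdot (wave_coef N) _ _ _.
Next Obligation.
  unfold wave_coef. destruct (Z.eq_dec 0 N); [lia |].
  destruct (Z.eq_dec 0 (- N)); [lia | reflexivity].
Qed.
Next Obligation.
  unfold wave_coef.
  destruct (Z.eq_dec (- k) N), (Z.eq_dec (- k) (- N)), (Z.eq_dec k N), (Z.eq_dec k (- N));
    try lia; apply injective_projections; simpl; ring.
Qed.
Next Obligation. eexists. apply (wave_sobolev s N HN). Qed.

Lemma norm_wave_le (s : R) (N : Z) (HN : (0 < N)%Z) :
  norm (wave s N HN) <= 2 * Rpower (japanese N) s.
Proof.
  change (sqrt (Series (sobolev_term s (wave_coef N))) <= 2 * Rpower (japanese N) s).
  rewrite (is_series_unique _ _ (wave_sobolev s N HN)).
  set (r := Rpower (japanese N) s). assert (Hr : 0 < r) by apply exp_pos.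
  rewrite <- (sqrt_pow2 (2 * r)) by lra. apply sqrt_le_1_alt. nra.
Qed.

Lemma osc_fourier (f : R -> R) (k : Z) (c : R) : (forall x, continuous f x) ->
  osc f k c = cos c * fst (fourier f k) + sin c * snd (fourier f k).
Proof.
  intros Hf. pose proof (jointly_continuous_of_continuous f Hf) as Hf'.
  unfold osc.
  rewrite (mean_ext _ (fun x => cos c * (f x * cos (IZR k * x))
                                + - sin c * (f x * sin (IZR k * x)))).
  - rewrite mean_plus, !mean_scal by continuous_tac.
    unfold mean, fourier, fst, snd. ring.
  - intros x. rewrite cos_plus. ring.
Qed.

Lemma represents_wave (s : R) (N : Z) (HN : (0 < N)%Z) (h : R) :
  represents (scal h (wave s N HN)) (fun x => 2 * h * cos (IZR N * x)).
Proof.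
  intros k. change (Cmult (RtoC h) (wave_coef N k) = fourier (fun x => 2 * h * cos (IZR N * x)) k).
  set (f := fun x => 2 * h * cos (IZR N * x)).
  assert (Hf : forall x, continuous f x) by (unfold f; continuous_tac).
  assert (H : forall c, osc f k c = h * (if Z.eq_dec (k - N) 0 then cos c else 0)
                                    + h * (if Z.eq_dec (k + N) 0 then cos c else 0)).
  { intros c. unfold osc.
    rewrite (mean_ext _ (fun x => h * cos (IZR (k - N) * x + c)
                                  + h * cos (IZR (k + N) * x + c))).
    - rewrite mean_plus, !mean_scal, !mean_cos by continuous_tac. reflexivity.
    - intros x. unfold f. rewrite minus_IZR, plus_IZR.
      replace ((IZR k - IZR N) * x + c) with (IZR k * x + c - IZR N * x) by ring.
      replace ((IZR k + IZR N) * x + c) with (IZR k * x + c + IZR N * x) by ring.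
      set (b := IZR k * x + c). rewrite cos_minus, cos_plus. ring. }
  (* The phases 0 and [PI / 2] give the real and the imaginary part of the coefficient. *)
  pose proof (H 0) as H0. pose proof (H (PI / 2)) as H1.
  rewrite osc_fourier, cos_0, sin_0 in H0 by exact Hf.
  rewrite osc_fourier, cos_PI2, sin_PI2 in H1 by exact Hf.
  apply injective_projections; unfold wave_coef;
    destruct (Z.eq_dec k N), (Z.eq_dec k (- N)), (Z.eq_dec (k - N) 0),
      (Z.eq_dec (k + N) 0); try lia; cbn [Cmult RtoC fst snd]; lra.
Qed.

(** Each derivative multiplies by [q] and advances the phase by [PI / 2], which gives a closed form
    at every order. *)
Lemma smooth_cos (a q : R) : smooth (fun x => a * cos (q * x)).
Proof.
  assert (H : forall n x, Derive_n (fun x => a * cos (q * x)) n x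
                          = a * q ^ n * cos (q * x + INR n * (PI / 2))).
  { induction n as [| n IH]; intros x.
    - simpl. rewrite Rmult_0_l, Rplus_0_r. ring.
    - change (Derive (Derive_n (fun x => a * cos (q * x)) n) x
              = a * q ^ S n * cos (q * x + INR (S n) * (PI / 2))).
      rewrite (Derive_ext _ _ x IH). apply is_derive_unique.
      auto_derive; [easy |]. rewrite S_INR.
      replace (q * x + (INR n + 1) * (PI / 2)) with (PI / 2 + (q * x + INR n * (PI / 2)))
        by ring.
      rewrite <- (Ropp_involutive (cos (PI / 2 + _))), <- sin_cos. simpl. ring. }
  intros [| n] x; [exact I |].
  apply ex_derive_ext with (fun x => a * q ^ n * cos (q * x + INR n * (PI / 2))).
  - intros y. symmetry. apply H.
  - auto_derive. easy.
Qed.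

Lemma mean_zero_wave (a : R) (N : Z) : (0 < N)%Z ->
  mean_zero (fun x => a * cos (IZR N * x)).
Proof.
  intros HN.
  assert (H : mean (fun x => a * cos (IZR N * x)) = 0).
  { rewrite (mean_ext _ (fun x => a * cos (IZR N * x + 0))).
    - rewrite mean_scal, mean_cos by continuous_tac.
      destruct (Z.eq_dec N 0); [lia | ring].
    - intros x. rewrite Rplus_0_r. reflexivity. }
  unfold mean in H. pose proof inv_2PI_gt_0.
  apply Rmult_integral in H. destruct H; [lra | assumption].
Qed.

(** The counterpart of [osc] on Fourier coefficients, so that it makes sense on all of [Hdot s]. *)
Definition phase_functional {s : R} (N : Z) (c : R) (f : Hdot s) : R :=
  cos c * fst (fcoef f N) + sin c * snd (fcoef f N).

Lemma Rabs_phase_functional_le {s : R} (N : Z) (c : R) (f : Hdot s) :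
  Rabs (phase_functional N c f) <= 2 * Rpower (japanese N) (- s) * norm f.
Proof.
  pose proof (weighted_le_Hdot_norm s f N) as H.
  pose proof (Rmax_Cmod (fcoef f N)) as H1.
  set (r := Rpower (japanese N) s) in *. assert (Hr : 0 < r) by apply exp_pos.
  rewrite Rpower_Ropp. fold r.
  apply Rle_trans with (2 * Cmod (fcoef f N)).
  - pose proof (Rmax_l (Rabs (fst (fcoef f N))) (Rabs (snd (fcoef f N)))).
    pose proof (Rmax_r (Rabs (fst (fcoef f N))) (Rabs (snd (fcoef f N)))).
    pose proof (Rabs_pos (fst (fcoef f N))). pose proof (Rabs_pos (snd (fcoef f N))).
    assert (Rabs (cos c) <= 1) by (apply Rabs_le, COS_bound).
    assert (Rabs (sin c) <= 1) by (apply Rabs_le, SIN_bound).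
    unfold phase_functional. eapply Rle_trans; [apply Rabs_triang |].
    rewrite !Rabs_mult. nra.
  - rewrite Rmult_assoc. apply Rmult_le_compat_l; [lra |].
    replace (Cmod (fcoef f N)) with (/ r * (r * Cmod (fcoef f N))) by (field; lra).
    apply Rmult_le_compat_l; [left; apply Rinv_0_lt_compat, Hr | exact H].
Qed.

Lemma is_linear_phase_functional {s : R} (N : Z) (c : R) :
  is_linear (U := Hdot_NormedModule s) (V := R_NormedModule) (phase_functional N c).
Proof.
  split.
  - intros f g. unfold phase_functional.
    change (fcoef (plus f g) N) with (Cplus (fcoef f N) (fcoef g N)).
    change plus with Rplus. simpl. ring.
  - intros a f. unfold phase_functional.
    change (fcoef (scal a f) N) with (Cmult (RtoC a) (fcoef f N)).
    change scal with Rmult. simpl. ring.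
  - exists (2 * Rpower (japanese N) (- s)). split.
    + pose proof (exp_pos (- s * ln (japanese N))). unfold Rpower. lra.
    + intros f. apply Rabs_phase_functional_le.
Qed.

(** * The cubic coefficient and its upper bound under smoothness *)

Definition resonance (alpha beta : R) (N : Z) : R :=
  dispersion alpha beta (2 * N) - 2 * dispersion alpha beta N.

Definition third_iterate (alpha beta gamma T : R) (N : Z) : R :=
  4 * gamma ^ 2 * IZR N ^ 2 / resonance alpha beta N
  * (T - sin (resonance alpha beta N * T) / resonance alpha beta N).

(** The wave is smooth with mean zero, so [flow] is the classical flow on it. The phase
    [PI / 2 - dispersion * T] undoes the free evolution and reads off the imaginary part of the
    profile. *)
Lemma flow_wave_expansion (alpha beta gamma s T : R) (flow : Hdot s -> Hdot s)
    (N : Z) (HN : (0 < N)%Z) (h : R) :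
  0 < T -> is_flow_map alpha beta gamma T flow -> resonance alpha beta N <> 0 -> 0 <= h ->
  Rabs (phase_functional N (PI / 2 - dispersion alpha beta N * T)
          (flow (scal h (wave s N HN)))
        - third_iterate alpha beta gamma T N * h ^ 3)
  <= 20 * (2 * Rabs gamma * IZR N * T) ^ 3 * h ^ 4.
Proof.
  intros HT Hflow HD Hh.
  destruct (Hflow (fun x => 2 * h * cos (IZR N * x)) (scal h (wave s N HN)))
    as [u [Hu Hrep]].
  - intros x. f_equal. rewrite <- (Rplus_0_r (IZR N * (x + 2 * PI))).
    rewrite (periodic_cos_IZR N 0 x), Rplus_0_r. reflexivity.
  - apply smooth_cos.
  - apply mean_zero_wave, HN.
  - apply represents_wave.
  - pose proof (classical_solution_jet _ _ _ _ _ _ HT Hu) as Hw.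
    pose proof (profile_third_order _ _ _ _ _ _ _ HT HN Hh Hw HD) as H.
    replace (phase_functional _ _ _) with
      (profile alpha beta (fun j t => Derive_n (u (clamp T t)) j) N (PI / 2) T).
    + exact H.
    + unfold profile. simpl (Derive_n _ 0). rewrite (clamp_id T T) by lra.
      unfold phase_functional. rewrite Hrep. apply osc_fourier.
      intros x. apply (ex_derive_continuous (u T)).
      apply (sol_dx _ _ _ _ _ _ Hu 1%nat T x); [lia | lra].
Qed.

Lemma Rle_of_small_error (a b C h0 : R) :
  0 < h0 -> (forall h, 0 < h < h0 -> a <= b + C * h) -> a <= b.
Proof.
  intros Hh0 H. apply Rnot_lt_le. intros Hab.
  set (h := Rmin (h0 / 2) ((a - b) / (2 * (Rabs C + 1)))).
  pose proof (Rabs_pos C) as HC.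
  assert (Hq : 0 < (a - b) / (2 * (Rabs C + 1))) by (apply Rdiv_lt_0_compat; lra).
  assert (Hh : 0 < h < h0).
  { split; [apply Rmin_glb_lt; lra |].
    apply Rle_lt_trans with (h0 / 2); [apply Rmin_l | lra]. }
  specialize (H h Hh).
  assert (Hle : h * (2 * (Rabs C + 1)) <= a - b).
  { apply Rle_trans with ((a - b) / (2 * (Rabs C + 1)) * (2 * (Rabs C + 1))).
    - apply Rmult_le_compat_r; [lra | apply Rmin_r].
    - right. field. lra. }
  pose proof (Rle_abs C). nra.
Qed.

(** The third difference of [t3 y^3] with step [h] is [6 t3 h^3], since 27 - 3 * 8 + 3 = 6. After
    division by [h^3] the quartic remainder is [O(h)]; it depends badly on [N], but [h] tends to 0
    with [N] fixed. *)
Lemma third_iterate_bound (alpha beta gamma s T : R) (flow : Hdot s -> Hdot s) :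
  0 < T -> is_flow_map alpha beta gamma T flow -> class_C 3 flow ->
  exists K, 0 < K /\ forall N : Z, (0 < N)%Z -> resonance alpha beta N <> 0 ->
    6 * Rabs (third_iterate alpha beta gamma T N) <= K * Rpower (japanese N) (2 * s).
Proof.
  intros HT Hflow HC.
  destruct (class_C_3_third_difference flow HC) as [K [delta [HK [Hdelta Hdiff]]]].
  exists (16 * K). split; [lra |]. intros N HN HD.
  set (phi := wave s N HN).
  set (A := 20 * (2 * Rabs gamma * IZR N * T) ^ 3).
  set (t3 := third_iterate alpha beta gamma T N).
  pose proof (norm_ge_0 phi) as Hphi0.
  (* The errors at [3 h], [2 h] and [h] add up to 81 + 3 * 16 + 3 = 132; the range of [h] keeps
     [3 h phi] in the ball of radius [delta]. *)
  apply (Rle_of_small_error _ _ (132 * A) (delta / (3 * (norm phi + 1)))).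
  { apply Rdiv_lt_0_compat; lra. }
  intros h Hh.
  set (l := phase_functional (s := s) N (PI / 2 - dispersion alpha beta N * T)).
  assert (Hsmall : 3 * h * norm phi < delta).
  { assert (h * (3 * (norm phi + 1)) < delta); [| nra].
    replace delta with (delta / (3 * (norm phi + 1)) * (3 * (norm phi + 1)))
      by (field; lra).
    apply Rmult_lt_compat_r; lra. }
  assert (Hr : 0 < Rpower (japanese N) s) by apply exp_pos.
  assert (Hr' : 0 < Rpower (japanese N) (- s)) by apply exp_pos.
  pose proof (Hdiff l (2 * Rpower (japanese N) (- s)) phi h
    (is_linear_phase_functional N _) (Rabs_phase_functional_le N _)
    ltac:(lra) ltac:(lra) Hsmall) as H.
  set (g := fun y => l (flow (scal y phi))).
  change (Rabs (g (3 * h) - 3 * g (2 * h) + 3 * g h - g 0)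
          <= 2 * Rpower (japanese N) (- s) * K * norm phi ^ 3 * h ^ 3) in H.
  assert (Hexp : forall y, 0 <= y -> Rabs (g y - t3 * y ^ 3) <= A * y ^ 4).
  { intros y Hy. apply (flow_wave_expansion _ _ _ _ _ _ _ HN); assumption. }
  pose proof (Hexp (3 * h) ltac:(lra)) as E3.
  pose proof (Hexp (2 * h) ltac:(lra)) as E2.
  pose proof (Hexp h ltac:(lra)) as E1.
  pose proof (Hexp 0 ltac:(lra)) as E0.
  (* One factor with exponent [- s] from the functional meets three with exponent [s] from the wave:
     the net exponent is [2 s], and the constant is 2 * 2^3 = 16. *)
  assert (Hb : 2 * Rpower (japanese N) (- s) * K * norm phi ^ 3
               <= 16 * K * Rpower (japanese N) (2 * s)).
  { replace (2 * s) with (s + s) by ring. rewrite Rpower_plus, Rpower_Ropp.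
    set (r := Rpower (japanese N) s) in *.
    replace (16 * K * (r * r)) with (2 * / r * K * (2 * r) ^ 3) by (field; lra).
    apply Rmult_le_compat_l.
    - apply Rmult_le_pos; [| lra]. pose proof (Rinv_0_lt_compat r Hr). lra.
    - apply pow_incr. split; [exact Hphi0 | apply norm_wave_le]. }
  set (B := 16 * K * Rpower (japanese N) (2 * s)) in *.
  assert (Hh3 : 0 < h ^ 3) by (apply pow_lt; lra).
  apply Rmult_le_reg_r with (h ^ 3); [exact Hh3 |].
  apply (Rmult_le_compat_r (h ^ 3)) in Hb; [| lra].
  apply Rle_trans with (Rabs (6 * t3 * h ^ 3)).
  { rewrite Rabs_mult, Rabs_mult, (Rabs_pos_eq 6), (Rabs_pos_eq (h ^ 3)) by lra. lra. }
  replace ((B + 132 * A * h) * h ^ 3)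
    with (B * h ^ 3 + A * (81 + 3 * 16 + 3) * h ^ 4) by ring.
  apply Rabs_le_between in E3, E2, E1, E0, H. apply Rabs_le.
  replace ((3 * h) ^ 3) with (27 * h ^ 3) in E3 by ring.
  replace ((3 * h) ^ 4) with (81 * h ^ 4) in E3 by ring.
  replace ((2 * h) ^ 3) with (8 * h ^ 3) in E2 by ring.
  replace ((2 * h) ^ 4) with (16 * h ^ 4) in E2 by ring.
  lra.
Qed.

(** * Lower bound for the cubic coefficient *)

Lemma resonance_eq (alpha beta : R) (N : Z) :
  resonance alpha beta N = 30 * alpha * IZR N ^ 5 - 6 * beta * IZR N ^ 3.
Proof. unfold resonance, dispersion. rewrite mult_IZR. ring. Qed.

(** For such [N] the [beta] term is at most a fifth of the [alpha] term, whence 24 = 30 - 6 and 36 =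
    30 + 6. The lower bound is weakened to first order in [N], enough to make the resonance
    large. *)
Lemma resonance_bounds (alpha beta : R) (N : Z) :
  (0 < N)%Z -> Rabs beta <= Rabs alpha * IZR N ->
  24 * Rabs alpha * IZR N <= Rabs (resonance alpha beta N) <= 36 * Rabs alpha * IZR N ^ 5.
Proof.
  intros HN Hb. assert (Hn : 1 <= IZR N) by (apply (IZR_le 1); lia).
  set (n := IZR N) in *. rewrite resonance_eq. fold n.
  assert (H5 : Rabs (30 * alpha * n ^ 5) = 30 * Rabs alpha * n ^ 5).
  { rewrite !Rabs_mult, (Rabs_pos_eq 30), (Rabs_pos_eq (n ^ 5)) by (try apply pow_le; lra).
    reflexivity. }
  assert (H3 : Rabs (6 * beta * n ^ 3) <= 6 * Rabs alpha * n ^ 5).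
  { rewrite !Rabs_mult, (Rabs_pos_eq 6), (Rabs_pos_eq (n ^ 3)) by (try apply pow_le; lra).
    pose proof (Rabs_pos alpha). pose proof (pow_le n 3 ltac:(lra)).
    pose proof (pow_le n 4 ltac:(lra)).
    apply Rle_trans with (6 * (Rabs alpha * n) * n ^ 3).
    - apply Rmult_le_compat_r; lra.
    - replace (6 * (Rabs alpha * n) * n ^ 3) with (6 * Rabs alpha * n ^ 4 * 1) by ring.
      replace (6 * Rabs alpha * n ^ 5) with (6 * Rabs alpha * n ^ 4 * n) by ring.
      apply Rmult_le_compat_l; [apply Rmult_le_pos; lra | exact Hn]. }
  assert (Hpow : n <= n ^ 5).
  { replace (n ^ 5) with (n * n ^ 4) by ring.
    pose proof (pow_R1_Rle n 4 Hn). nra. }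
  pose proof (Rabs_pos alpha). split.
  - pose proof (Rabs_triang_inv (30 * alpha * n ^ 5) (6 * beta * n ^ 3)). nra.
  - pose proof (Rabs_triang (30 * alpha * n ^ 5) (- (6 * beta * n ^ 3))) as Htri.
    rewrite Rabs_Ropp in Htri. unfold Rminus. lra.
Qed.

(** The last hypothesis gives [|D| T >= 2], so the oscillating term is at most [T / 2] and half of
    the linear growth survives. The upper bound on the resonance then gives 4 / (36 * 2) = 1 /
    18. *)
Lemma third_iterate_lower_bound (alpha beta gamma T : R) (N : Z) :
  0 < T -> alpha <> 0 -> (0 < N)%Z -> Rabs beta <= Rabs alpha * IZR N ->
  2 <= 24 * Rabs alpha * IZR N * T ->
  gamma ^ 2 * T / (18 * Rabs alpha) <= IZR N ^ 3 * Rabs (third_iterate alpha beta gamma T N).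
Proof.
  intros HT Halpha HN Hb HNT.
  destruct (resonance_bounds alpha beta N HN Hb) as [Hlow Hup].
  assert (Hn : 1 <= IZR N) by (apply (IZR_le 1); lia).
  pose proof (Rabs_pos_lt alpha Halpha) as Ha.
  unfold third_iterate. set (D := resonance alpha beta N) in *. set (n := IZR N) in *.
  assert (HD : 0 < Rabs D) by nra.
  assert (HD0 : D <> 0) by (intros E; rewrite E, Rabs_R0 in HD; lra).
  assert (Hosc : T / 2 <= T - sin (D * T) / D).
  { assert (Rabs (sin (D * T) / D) <= T / 2); [| pose proof (Rle_abs (sin (D * T) / D)); lra].
    unfold Rdiv. rewrite Rabs_mult, Rabs_inv.
    apply Rle_trans with (1 * / Rabs D).
    - apply Rmult_le_compat_r; [left; apply Rinv_0_lt_compat, HD |].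
      apply Rabs_le, SIN_bound.
    - apply Rmult_le_reg_r with (Rabs D); [exact HD |].
      rewrite Rmult_1_l, Rinv_l by lra. nra. }
  rewrite Rabs_mult. unfold Rdiv at 2. rewrite Rabs_mult, Rabs_inv.
  rewrite (Rabs_pos_eq (T - _)) by lra.
  assert (Hg : 0 <= gamma ^ 2) by apply pow2_ge_0.
  assert (Hn2 : 0 < n ^ 2) by (apply pow_lt; lra).
  assert (Hn3 : 0 < n ^ 3) by (apply pow_lt; lra).
  assert (Hn5 : 0 < n ^ 5) by (apply pow_lt; lra).
  rewrite (Rabs_pos_eq (4 * gamma ^ 2 * n ^ 2)) by nra.
  apply Rle_trans with (n ^ 3 * (4 * gamma ^ 2 * n ^ 2 * / (36 * Rabs alpha * n ^ 5) * (T / 2))).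
  - right. field. lra.
  - apply Rmult_le_compat_l; [lra |].
    apply Rmult_le_compat; [| lra | | exact Hosc].
    + apply Rmult_le_pos; [nra |]. left. apply Rinv_0_lt_compat. nra.
    + apply Rmult_le_compat_l; [nra |]. apply Rinv_le_contravar; [exact HD | exact Hup].
Qed.

Lemma Rpower_japanese_le (N : Z) (s : R) : (0 < N)%Z -> s <= 0 ->
  Rpower (japanese N) s <= Rpower (IZR N) s.
Proof.
  intros HN Hs. assert (Hn : 1 <= IZR N) by (apply (IZR_le 1); lia).
  assert (HJ : IZR N <= japanese N).
  { unfold japanese. rewrite <- (sqrt_pow2 (IZR N)) at 1 by lra.
    apply sqrt_le_1_alt. lra. }
  rewrite <- (Ropp_involutive s), !(Rpower_Ropp _ (- s)).
  apply Rinv_le_contravar; [apply exp_pos |].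
  apply Rle_Rpower_l; lra.
Qed.

Theorem theorem1p2 (alpha beta gamma s : R)
    (halpha : alpha <> 0) (hgamma : gamma <> 0) (hs : s < - (3 / 2)) :
  ~ (exists T : R, 0 < T /\
      forall t : R, 0 < t <= T ->
        exists flow : Hdot s -> Hdot s,
          is_flow_map alpha beta gamma t flow /\ class_C 3 flow).
Proof.
  intros [T [HT H]]. destruct (H T ltac:(lra)) as [flow [Hflow HC]].
  destruct (third_iterate_bound _ _ _ _ _ _ HT Hflow HC) as [K [HK Hbound]].
  pose proof (Rabs_pos_lt alpha halpha) as Ha. pose proof (Rabs_pos beta) as Hb0.
  set (c := gamma ^ 2 * T / (18 * Rabs alpha)).
  assert (Hc : 0 < c).
  { apply Rdiv_lt_0_compat; [| lra]. apply Rmult_lt_0_compat; [| exact HT].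
    apply pow2_gt_0, hgamma. }
  (* Three thresholds for [N]: beyond [X1] the fifth-order dispersion dominates, beyond [X2] the
     oscillating term is absorbed, and [X3] solves [K X^(2 s + 3) = c]. *)
  set (X1 := Rabs beta / Rabs alpha). set (X2 := 2 / (24 * Rabs alpha * T)).
  set (X3 := exp (ln (K / c) / - (2 * s + 3))).
  assert (HX1 : 0 <= X1) by (apply Rdiv_le_0_compat; lra).
  assert (HX2 : 0 < X2) by (apply Rdiv_lt_0_compat; nra).
  assert (HX3 : 0 < X3) by apply exp_pos.
  set (N := up (X1 + X2 + X3)).
  destruct (archimed (X1 + X2 + X3)) as [Hup _]. fold N in Hup.
  assert (HN : (0 < N)%Z) by (apply lt_IZR; lra).
  assert (HbN : Rabs beta <= Rabs alpha * IZR N).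
  { apply Rle_trans with (Rabs alpha * X1).
    - right. unfold X1. field. lra.
    - apply Rmult_le_compat_l; lra. }
  assert (HTN : 2 <= 24 * Rabs alpha * IZR N * T).
  { apply Rle_trans with (24 * Rabs alpha * X2 * T).
    - right. unfold X2. field. lra.
    - apply Rmult_le_compat_r; [lra |]. apply Rmult_le_compat_l; lra. }
  assert (HD : resonance alpha beta N <> 0).
  { destruct (resonance_bounds alpha beta N HN HbN) as [Hl _]. intros E.
    rewrite E, Rabs_R0 in Hl. nra. }
  pose proof (third_iterate_lower_bound alpha beta gamma T N HT halpha HN HbN HTN) as Hlow.
  fold c in Hlow.
  specialize (Hbound N HN HD).
  pose proof (Rpower_japanese_le N (2 * s) HN ltac:(lra)) as HJ.
  assert (Hn : 0 < IZR N) by (apply IZR_lt, HN).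
  assert (Hn3 : 0 < IZR N ^ 3) by (apply pow_lt, Hn).
  assert (Hpow : IZR N ^ 3 * Rpower (IZR N) (2 * s) = Rpower (IZR N) (2 * s + 3)).
  { rewrite Rpower_plus. replace 3 with (INR 3) by (simpl; ring).
    rewrite Rpower_pow by exact Hn. ring. }
  (* Since [s < - 3 / 2], the exponent [2 s + 3] is negative and the power decreases in [N]; going
     beyond [X3] makes the inequality strict. *)
  assert (Hsmall : K * Rpower (IZR N) (2 * s + 3) < c).
  { assert (Hln : ln (K / c) / - (2 * s + 3) < ln (IZR N)).
    { rewrite <- (ln_exp (ln (K / c) / - (2 * s + 3))). apply ln_increasing; [exact HX3 |].
      fold X3. lra. }
    assert (Hln2 : (2 * s + 3) * ln (IZR N) < ln (c / K)).
    { replace (c / K) with (/ (K / c)) by (field; lra).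
      rewrite ln_Rinv by (apply Rdiv_lt_0_compat; lra).
      apply (Rmult_lt_compat_r (- (2 * s + 3))) in Hln; [| lra].
      replace (ln (K / c) / - (2 * s + 3) * - (2 * s + 3)) with (ln (K / c)) in Hln
        by (field; lra).
      lra. }
    apply exp_increasing in Hln2.
    rewrite (exp_ln (c / K)) in Hln2 by (apply Rdiv_lt_0_compat; lra).
    unfold Rpower. apply (Rmult_lt_compat_l K) in Hln2; [| exact HK].
    replace (K * (c / K)) with c in Hln2 by (field; lra). exact Hln2. }
  assert (Hmid : IZR N ^ 3 * (K * Rpower (japanese N) (2 * s)) <= K * Rpower (IZR N) (2 * s + 3)).
  { rewrite <- Hpow.
    replace (K * (IZR N ^ 3 * Rpower (IZR N) (2 * s)))
      with (IZR N ^ 3 * (K * Rpower (IZR N) (2 * s))) by ring.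
    apply Rmult_le_compat_l; [lra |]. apply Rmult_le_compat_l; lra. }
  (* Multiplied by [N^3], six times the coefficient is now below [c], while the coefficient itself
     is at least [c]. *)
  apply (Rmult_le_compat_l (IZR N ^ 3)) in Hbound; [| lra].
  pose proof (Rabs_pos (third_iterate alpha beta gamma T N)). nra.
Qed.
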